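(* Let $\Bbbk$ be a field of characteristic zero and $H=\Bbbk[\partial]$. Let $C$ be an associative conformal algebra generated by a set $X$ relative to a locality function $N:X\times X\to\mathbb Z_+$, with defining relations $S\subset A(X)\otimes \Bbbk X$. Let $M$ be a left conformal $C$-module generated by a set $Y$ (disjoint from $X$) relative to a locality function $N':X\times Y\to\mathbb Z_+$, with defining relations $T\subset A(X)\otimes\Bbbk Y$. Consider the split null extension $C\oplus M$ as an associative conformal algebra generated by $X\cup Y$ relative to the locality function $N$ on $(X\cup Y)\times(X\cup Y)$ that equals $N$ on $X\times X$, equals $N'$ on $X\times Y$, and is zero on $Y\times X$ and $Y\times Y$. Then the defining relations of $C\oplus M$, written as elements of the free $A(X\cup Y)$-module $A(X\cup Y)\otimes\Bbbk(X\cup Y)$, are $S\cup T$ along with $$L_n^y u,\qquad y\in Y,\ n\ge 0,\ u\in A(X\cup Y)\otimes\Bbbk(X\cup Y).$$ That is, $C\oplus M$ is isomorphic, as an $A(X\cup Y)$-module, to the quotient of $M(X\cup Y,N)$ by the $A(X\cup Y)$-submodule generated by the images of all these elements.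
   Context: Associative conformal algebra: a left $H$-module $C$ with a $\Bbbk$-bilinear operation $(\cdot\,{}_{(\lambda)}\,\cdot):C\otimes C\to C[\lambda]$ such that $(\partial a\,{}_{(\lambda)}\,b)=-\lambda(a\,{}_{(\lambda)}\,b)$, $(a\,{}_{(\lambda)}\,\partial b)=(\partial+\lambda)(a\,{}_{(\lambda)}\,b)$ and $(a\,{}_{(\lambda)}(b\,{}_{(\mu)}c))=((a\,{}_{(\lambda)}b)\,{}_{(\lambda+\mu)}c)$. A left conformal $C$-module is an $H$-module $M$ with an operation $(\cdot\,{}_{(\lambda)}\,\cdot):C\otimes M\to M[\lambda]$ satisfying the same identities. $C$ is generated by $X$ relative to a locality function $N$ if for all $a,b\in X$ the polynomial $(a\,{}_{(\lambda)}b)$ has degree $<N(a,b)$ in $\lambda$ (so it is zero if $N(a,b)=0$); similarly $N'(x,y)$ bounds the degree of $(x\,{}_{(\lambda)}y)$ for $x\in X$, $y\in Y$. The algebra $A(Z)$: for a set $Z$, $A(Z)$ is the (ordinary) unital associative algebra generated by $\{\partial\}\cup\{L_n^a,R_n^a\mid a\in Z,\ n\in\mathbb Z_+\}$, where $\mathbb Z_+=\{0,1,2,\dots\}$, with defining relations (for $a,b\in Z$, $n,m\ge0$) $$L_n^a\partial-\partial L_n^a-nL_{n-1}^a,\qquad R_n^a\partial-\partial R_n^a-nR_{n-1}^a,\qquad R_n^aL_m^b-L_m^bR_n^a.$$ For a function $N:Z\times Z\to\mathbb Z_+$, $M(Z,N)$ is the left $A(Z)$-module generated by $Z$ with relations $$L_n^ab=0\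 \ (n\ge N(a,b)),\qquad R_m^ba=\sum_{s=0}^{N(a,b)-m}(-1)^{m+s}\frac1{s!}\partial^sL_{m+s}^ab\ \ (m\in\mathbb Z_+),\qquad a,b\in Z.$$ An associative conformal algebra generated by $Z$ is an $A(Z)$-module via $(a\,{}_{(\lambda)}u)=\sum_{n\ge0}\frac{\lambda^n}{n!}L_n^au$ and $(u\,{}_{(-\lambda-\partial)}a)=\sum_{n\ge0}\frac{\lambda^n}{n!}R_n^au$ for $a\in Z$. The free associative conformal algebra $\mathrm{Conf}(Z,N)$ generated by $Z$ relative to $N$ is isomorphic to $M(Z,N)$ as an $A(Z)$-module (a known fact), and its ideals are exactly its $A(Z)$-submodules. ''$C$ has defining relations $S\subset A(X)\otimes\Bbbk X$'' means that $C$ is the quotient of $\mathrm{Conf}(X,N)\cong M(X,N)$ by the $A(X)$-submodule generated by the image of $S$ (here $\Bbbk X$ is the vector space with basis $X$ and $A(X)\otimes\Bbbk X$ is the free left $A(X)$-module on $X$). ''$M$ has defining relations $T\subset A(X)\otimes\Bbbk Y$'' means that $M$ is the universal left conformal $C$-module generated by $Y$ in which $L_n^xy=0$ for $n\ge N'(x,y)$ and all elements of $T$ vanish; here $L_n^x$ acts on $M$ by $(x\,{}_{(\lambda)}w)=\sum_{n\ge0}\frac{\lambda^n}{n!}L_n^xw$ and the operators $R_n^x$ act on $M$ as zero. The split null extension $C\oplus M$ is the associative conformal algebra whose $\lambda$-product extends that of $C$ and the action of $C$ on $M$, with $(M\,{}_{(\lambda)}M)=(M\,{}_{(\lambda)}C)=0$.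 *)

(* Defs.v *)
(* The finitely supported functions [{malg G[K]}] are used three times:
   [{malg k[{fmonom I}]}] is the free associative algebra on [I];
   [{malg A[W]}] is the free left [A]-module on [W]; and
   [{lpoly V}] := [{malg V[nat]}] is V[lambda], where [p@_n] is the coefficient
   of lambda^n.  H = k[d] is [{poly k}], and d acts on a module as ['X *: _].
   Every set of generators is a [choiceType]; classically this excludes
   nothing. *)
From HB Require Import structures.
From mathcomp Require Import all_boot all_algebra.
From mathcomp Require Import finmap zify ring.
From mathcomp Require Import boolp classical_sets.
From mathcomp.multinomials Require Import monalg.

Set Implicit Arguments.
Unset Strict Implicit.
Unset Printing Implicit Defensive.

Import GRing.Theory Quotient.

Local Open Scope classical_set_scope.
Local Open Scope ring_scope.
Local Open Scope quotient_scope.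

Section QuotientModule.
Context (A : pzRingType) (V : lmodType A).

Definition is_submod (P : set V) : Prop :=
  P 0 /\ forall (a : A) (u v : V), P u -> P v -> P (a *: u + v).

Definition submod_gen (G : set V) : set V := smallest is_submod G.

Lemma submod_genP (G : set V) : is_submod (submod_gen G).
Proof.
split=> [P [[]]//|a u v Gu Gv P PG].
by case: (PG) => -[_ h] _; apply: h; [apply: Gu|apply: Gv].
Qed.

Definition in_submod_gen (G : set V) : pred V := fun v => `[< submod_gen G v >].

Lemma in_submod_gen_zmod_closed (G : set V) : zmod_closed (in_submod_gen G).
Proof.
case: (submod_genP G) => h0 h; split; first exact/asboolP.
move=> u v /asboolP Gu /asboolP Gv; apply/asboolP.
by rewrite addrC -scaleN1r; apply: h.
Qed.

HB.instance Definition _ (G : set V) :=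
  GRing.isZmodClosed.Build V (in_submod_gen G) (in_submod_gen_zmod_closed G).

Definition submod_gen_zmod (G : set V) : zmodClosed V :=
  GRing.ZmodClosed.clone V (in_submod_gen G) _.
Definition quotmod (G : set V) : Type := {quot (submod_gen_zmod G)}.

Section Quotmod.
Context (G : set V).
HB.instance Definition _ := GRing.Zmodule.on (quotmod G).
HB.instance Definition _ := EqQuotient.on (quotmod G).

Definition qproj (v : V) : quotmod G := \pi_{quot (submod_gen_zmod G)} v.

Lemma qproj_eq (u v : V) : qproj u = qproj v <-> submod_gen G (u - v).
Proof.
split=> [/eqP|h]; first by rewrite /qproj -idealrBE => /asboolP.
by apply/eqP; rewrite /qproj -idealrBE; apply/asboolP.
Qed.

Lemma qproj_repr (x : quotmod G) : qproj (repr x) = x.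
Proof. exact: (@reprK _ {quot (submod_gen_zmod G)}). Qed.

Lemma qprojD (u v : V) : qproj (u + v) = qproj u + qproj v.
Proof. exact: (raddfD \pi_{quot (submod_gen_zmod G)}). Qed.

Definition quotmod_scale (a : A) (x : quotmod G) : quotmod G :=
  qproj (a *: repr x).

Lemma qprojZ (a : A) (v : V) : qproj (a *: v) = quotmod_scale a (qproj v).
Proof.
apply/qproj_eq; rewrite -scalerBr -[_ *: _]addr0.
case: (submod_genP G) => h0 h; apply: h => //.
by apply/qproj_eq; rewrite qproj_repr.
Qed.

Lemma quotmod_scaleA a b x :
  quotmod_scale a (quotmod_scale b x) = quotmod_scale (a * b) x.
Proof. by rewrite -(qproj_repr x) -!qprojZ scalerA. Qed.
Lemma quotmod_scale1 : left_id 1 quotmod_scale.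
Proof. by move=> x; rewrite -(qproj_repr x) -!qprojZ scale1r. Qed.
Lemma quotmod_scaleDr : right_distributive quotmod_scale +%R.
Proof.
move=> a x y; rewrite -(qproj_repr x) -(qproj_repr y) -qprojD.
by rewrite -!qprojZ scalerDr qprojD.
Qed.
Lemma quotmod_scaleDl x : {morph quotmod_scale^~ x : a b / a + b}.
Proof. by move=> a b; rewrite -(qproj_repr x) -!qprojZ scalerDl qprojD. Qed.

HB.instance Definition _ := GRing.Zmodule_isLmodule.Build A (quotmod G)
  quotmod_scaleA quotmod_scale1 quotmod_scaleDr quotmod_scaleDl.

Lemma qproj_is_linear : linear qproj.
Proof. by move=> a u v; rewrite qprojD qprojZ. Qed.
HB.instance Definition _ :=
  GRing.isLinear.Build A V (quotmod G) _ qproj qproj_is_linear.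
End Quotmod.
End QuotientModule.

Section GenDef.
Context (Z : choiceType).

(* The generators d, L_n^a and R_n^a. *)
Inductive gen := GD | GL of nat & Z | GR of nat & Z.

Definition gen_code (g : gen) : option (bool * nat * Z) :=
  match g with
  | GD => None | GL n a => Some (true, n, a) | GR n a => Some (false, n, a)
  end.
Definition gen_decode (c : option (bool * nat * Z)) : gen :=
  match c with
  | None => GD | Some (true, n, a) => GL n a | Some (false, n, a) => GR n a
  end.
Lemma gen_codeK : cancel gen_code gen_decode. Proof. by case. Qed.
HB.instance Definition _ := Equality.copy gen (can_type gen_codeK).
HB.instance Definition _ := Choice.copy gen (can_type gen_codeK).
End GenDef.
Arguments GD {Z}.

Section AlgebraA.
Context (k : fieldType) (Z : choiceType).

Local Notation freealg := {malg k[{fmonom gen Z}]}.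

Definition fgen (g : gen Z) : freealg := << fmu g >>.

(* At n = 0 the term with [n.-1] is multiplied by 0. *)
Definition Arel : set freealg :=
  [set p | exists n a, p = fgen (GL n a) * fgen GD - fgen GD * fgen (GL n a)
                           - fgen (GL n.-1 a) *+ n]
  `|` [set p | exists n a, p = fgen (GR n a) * fgen GD
                           - fgen GD * fgen (GR n a) - fgen (GR n.-1 a) *+ n]
  `|` [set p | exists n m a b, p = fgen (GR n a) * fgen (GL m b)
                                   - fgen (GL m b) * fgen (GR n a)].

Definition is_ideal (P : set freealg) : Prop :=
  [/\ P 0, forall p q, P p -> P q -> P (p - q),
      forall r p, P p -> P (r * p) & forall r p, P p -> P (p * r)].

Definition Aideal : set freealg := smallest is_ideal Arel.

Lemma Aideal_is_ideal : is_ideal Aideal.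
Proof.
split=> [P [[]]//|p q Ip Iq P PG|r p Ip P PG|r p Ip P PG];
  case: (PG) => -[_ h1 h2 h3] _.
- by apply: h1; [apply: Ip|apply: Iq].
- by apply: h2; apply: Ip.
- by apply: h3; apply: Ip.
Qed.

Definition in_Aideal : pred freealg := fun p => `[< Aideal p >].

Lemma in_Aideal_zmod_closed : zmod_closed in_Aideal.
Proof.
case: Aideal_is_ideal => h0 h _ _; split; first exact/asboolP.
by move=> u v /asboolP Gu /asboolP Gv; apply/asboolP; exact: h.
Qed.
HB.instance Definition _ :=
  GRing.isZmodClosed.Build freealg in_Aideal in_Aideal_zmod_closed.

Definition Aideal_zmod : zmodClosed freealg :=
  GRing.ZmodClosed.clone freealg in_Aideal _.
Definition algA : Type := {quot Aideal_zmod}.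
HB.instance Definition _ := GRing.Zmodule.on algA.
HB.instance Definition _ := EqQuotient.on algA.

Definition Aproj (p : freealg) : algA := \pi_{quot Aideal_zmod} p.

Lemma Aproj_eq (p q : freealg) : Aproj p = Aproj q <-> Aideal (p - q).
Proof.
split=> [/eqP|h]; first by rewrite /Aproj -idealrBE => /asboolP.
by apply/eqP; rewrite /Aproj -idealrBE; apply/asboolP.
Qed.

Lemma Aproj_repr (x : algA) : Aproj (repr x) = x.
Proof. exact: (@reprK _ {quot Aideal_zmod}). Qed.

Lemma AprojD (u v : freealg) : Aproj (u + v) = Aproj u + Aproj v.
Proof. exact: (raddfD \pi_{quot Aideal_zmod}). Qed.

Definition Amul (x y : algA) : algA := Aproj (repr x * repr y).

Lemma AprojM p q : Aproj (p * q) = Amul (Aproj p) (Aproj q).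
Proof.
case: Aideal_is_ideal => h0 hB hl hr.
have hN u : Aideal u -> Aideal (- u) by rewrite -sub0r; exact: hB.
have hD u v : Aideal u -> Aideal v -> Aideal (u + v).
  by move=> hu hv; rewrite -[v]opprK; apply: hB => //; exact: hN.
apply/Aproj_eq; set p' := repr _; set q' := repr _.
have -> : p * q - p' * q' = (p - p') * q + p' * (q - q').
  by rewrite mulrBl mulrBr addrA subrK.
apply: hD; first by apply: hr; apply/Aproj_eq; rewrite Aproj_repr.
by apply: hl; apply/Aproj_eq; rewrite Aproj_repr.
Qed.

Lemma AmulA : associative Amul.
Proof.
move=> x y z; rewrite -(Aproj_repr x) -(Aproj_repr y) -(Aproj_repr z).
by rewrite -!AprojM mulrA.
Qed.
Lemma Amul1l : left_id (Aproj 1) Amul.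
Proof. by move=> x; rewrite -(Aproj_repr x) -AprojM mul1r. Qed.
Lemma Amul1r : right_id (Aproj 1) Amul.
Proof. by move=> x; rewrite -(Aproj_repr x) -AprojM mulr1. Qed.
Lemma AmulDl : left_distributive Amul +%R.
Proof.
move=> x y z; rewrite -(Aproj_repr x) -(Aproj_repr y) -(Aproj_repr z).
by rewrite -AprojD -!AprojM mulrDl AprojD.
Qed.
Lemma AmulDr : right_distributive Amul +%R.
Proof.
move=> x y z; rewrite -(Aproj_repr x) -(Aproj_repr y) -(Aproj_repr z).
by rewrite -AprojD -!AprojM mulrDr AprojD.
Qed.

Lemma Aideal_coef1 (p : freealg) : Aideal p -> p@_mone = 0.
Proof.
have hg g : (fgen g)@_mone = 0 :> k by rewrite mcoeffU1 fm1_eq1.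
apply: (smallest_sub (X := [set p : freealg | p@_mone = 0])); first split=> /=.
- exact: raddf0.
- by move=> u v hu hv; rewrite raddfB /= hu hv subrr.
- by move=> r u hu; rewrite rmorphM /= hu mulr0.
- by move=> r u hu; rewrite rmorphM /= hu mul0r.
- have hB (u v : freealg) : u@_mone = 0 -> v@_mone = 0 -> (u - v)@_mone = 0.
    by move=> hu hv; rewrite raddfB /= hu hv subrr.
  have hM h (u : freealg) : (fgen h * u)@_mone = 0.
    by rewrite rmorphM /= hg mul0r.
  have hn h n : (fgen h *+ n)@_mone = 0 by rewrite mcoeffMn hg mul0rn.
  move=> _ [[[n [a ->]]|[n [a ->]]]|[n [m [a [b ->]]]]] /=.
  + by apply/hB; [apply/hB; exact: hM|exact: hn].
  + by apply/hB; [apply/hB; exact: hM|exact: hn].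
  + by apply/hB; exact: hM.
Qed.

Lemma A1_neq0 : Aproj 1 != 0.
Proof.
apply/eqP => h; have /Aproj_eq : Aproj 1 = Aproj 0.
  by rewrite h /Aproj raddf0.
by rewrite subr0 => /Aideal_coef1/eqP; rewrite mcoeff1 eqxx oner_eq0.
Qed.

HB.instance Definition _ := GRing.Zmodule_isNzRing.Build algA
  AmulA Amul1l Amul1r AmulDl AmulDr A1_neq0.

Lemma Aproj_is_monoid_morphism : monoid_morphism Aproj.
Proof. by split; [|exact: AprojM]. Qed.
Lemma Aproj_is_zmod_morphism : zmod_morphism Aproj.
Proof. exact: (raddfB \pi_{quot Aideal_zmod}). Qed.
HB.instance Definition _ :=
  GRing.isZmodMorphism.Build freealg algA Aproj Aproj_is_zmod_morphism.
HB.instance Definition _ :=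
  GRing.isMonoidMorphism.Build freealg algA Aproj Aproj_is_monoid_morphism.

Definition Ascale (c : k) (x : algA) : algA := Aproj c%:MP * x.

Lemma AscaleA a b x : Ascale a (Ascale b x) = Ascale (a * b) x.
Proof.
have e : (a * b)%:MP = a%:MP * b%:MP :> freealg by exact: mpolyCM.
transitivity (Aproj (a%:MP * b%:MP) * x).
  exact: etrans (mulrA _ _ _) (congr1 (fun y => y * x) (esym (AprojM _ _))).
exact: (congr1 (fun p => Aproj p * x) (esym e)).
Qed.
Lemma Ascale1 : left_id 1 Ascale.
Proof. by move=> x; rewrite /Ascale mpolyC1E rmorph1 mul1r. Qed.
Lemma AscaleDr : right_distributive Ascale +%R.
Proof. by move=> a x y; rewrite /Ascale mulrDr. Qed.
Lemma AscaleDl x : {morph Ascale^~ x : a b / a + b}.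
Proof. by move=> a b; rewrite /Ascale -mulrDl -rmorphD -monalgUD. Qed.
HB.instance Definition _ := GRing.Zmodule_isLmodule.Build k algA
  AscaleA Ascale1 AscaleDr AscaleDl.
Lemma AscaleAl (c : k) (x y : algA) : c *: (x * y) = c *: x * y.
Proof. exact: mulrA. Qed.
HB.instance Definition _ := GRing.Lmodule_isLalgebra.Build k algA AscaleAl.

Lemma malgC_central (c : k) (p : freealg) : c%:MP * p = p * c%:MP.
Proof.
rewrite !malgM_def (fgmulUg c) (fgmulgU c).
by apply: eq_bigr => m _; rewrite mul1m mulm1 mulrC.
Qed.
Lemma AscaleAr (c : k) (x y : algA) : c *: (x * y) = x * (c *: y).
Proof.
rewrite /GRing.scale /= /Ascale -(Aproj_repr x) mulrA -rmorphM malgC_central.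
by rewrite rmorphM mulrA.
Qed.
HB.instance Definition _ := GRing.Lalgebra_isAlgebra.Build k algA AscaleAr.

Definition Agen (g : gen Z) : algA := Aproj (fgen g).
End AlgebraA.

Section Operators.
Context (k : fieldType) (Z : choiceType) (V : lmodType {poly k}).

Local Notation freealg := {malg k[{fmonom gen Z}]}.

(* The k-linear operators defining an A(Z)-module structure on [V] in which d
   acts as ['X]. *)
Record ops := Ops {
  opL : nat -> Z -> V -> V;
  opR : nat -> Z -> V -> V;
  opL_lin : forall n a (c : k) u v,
    opL n a (c%:P *: u + v) = c%:P *: opL n a u + opL n a v;
  opR_lin : forall n a (c : k) u v,
    opR n a (c%:P *: u + v) = c%:P *: opR n a u + opR n a v;
  opL_del : forall n a v,
    opL n a ('X *: v) = 'X *: opL n a v + opL n.-1 a v *+ n;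
  opR_del : forall n a v,
    opR n a ('X *: v) = 'X *: opR n a v + opR n.-1 a v *+ n;
  opRL : forall n m a b v, opR n a (opL m b v) = opL m b (opR n a v)
}.

(* [V] itself, with the A(Z)-module structure determined by [o]. *)
Definition opmodule (o : ops) : Type := V.

Section Act.
Context (o : ops).

Definition op_gen (g : gen Z) (v : V) : V :=
  match g with
  | GD => 'X *: v
  | GL n a => opL o n a v
  | GR n a => opR o n a v
  end.

(* Words act on the left: g1 g2 ... gr v = g1 (g2 (... (gr v))). *)
Definition op_word (w : {fmonom gen Z}) (v : V) : V := foldr op_gen v w.

Definition op_free (p : freealg) (v : V) : V :=
  \sum_(w <- msupp p) (p@_w)%:P *: op_word w v.

Lemma op_gen_lin g (c : k) u v :
  op_gen g (c%:P *: u + v) = c%:P *: op_gen g u + op_gen g v.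
Proof.
case: g => [|n a|n a] /=; [|exact: opL_lin|exact: opR_lin].
by rewrite scalerDr !scalerA mulrC.
Qed.

Lemma op_word_lin w (c : k) u v :
  op_word w (c%:P *: u + v) = c%:P *: op_word w u + op_word w v.
Proof.
rewrite /op_word; case: w => w /=.
by elim: w => //= g w ->; rewrite op_gen_lin.
Qed.

Lemma op_word0 w : op_word w 0 = 0.
Proof.
by have := op_word_lin w (-1) 0 0; rewrite scaler0 addr0 polyCN scaleN1r addNr.
Qed.

Lemma op_wordD w u v : op_word w (u + v) = op_word w u + op_word w v.
Proof. by have := op_word_lin w 1 u v; rewrite !scale1r. Qed.

Lemma op_wordZ w (c : k) u : op_word w (c%:P *: u) = c%:P *: op_word w u.
Proof. by have := op_word_lin w c u 0; rewrite op_word0 !addr0. Qed.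

Lemma op_freeEw (d : {fset {fmonom gen Z}}) p v : (msupp p `<=` d)%fset ->
  op_free p v = \sum_(w <- d) (p@_w)%:P *: op_word w v.
Proof.
move=> le; rewrite [LHS](big_fset_incl _ le) => //= x xd /mcoeff_outdom ->.
by rewrite scale0r.
Qed.

Lemma op_freeU (c : k) w v : op_free << c *g w >> v = c%:P *: op_word w v.
Proof. by rewrite (op_freeEw _ msuppU_le) big_seq_fset1 mcoeffUU. Qed.

Lemma op_freeD p q v : op_free (p + q) v = op_free p v + op_free q v.
Proof.
pose d := (msupp p `|` msupp q)%fset.
rewrite (@op_freeEw d p) ?fsubsetUl // (@op_freeEw d q) ?fsubsetUr //.
rewrite (@op_freeEw d) ?msuppD_le // -big_split; apply: eq_bigr => w _ /=.
by rewrite mcoeffD polyCD scalerDl.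
Qed.

Lemma op_free0 v : op_free 0 v = 0.
Proof. by rewrite /op_free msupp0 big_seq_fset0. Qed.

Lemma op_freeN p v : op_free (- p) v = - op_free p v.
Proof. by apply/eqP; rewrite -addr_eq0 -op_freeD addNr op_free0. Qed.

Lemma op_freeMn p n v : op_free (p *+ n) v = op_free p v *+ n.
Proof.
by elim: n => [|n IH]; rewrite ?mulr0n ?op_free0 // !mulrS op_freeD IH.
Qed.

Lemma op_free_lin p (c : k) u v :
  op_free p (c%:P *: u + v) = c%:P *: op_free p u + op_free p v.
Proof.
rewrite /op_free scaler_sumr -big_split; apply: eq_bigr => w _ /=.
by rewrite op_word_lin scalerDr !scalerA mulrC.
Qed.

Lemma op_free_vD p u v : op_free p (u + v) = op_free p u + op_free p v.
Proof. by have := op_free_lin p 1 u v; rewrite !scale1r. Qed.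

Lemma op_free_v0 p : op_free p 0 = 0.
Proof. by rewrite /op_free big1 // => w _; rewrite op_word0 scaler0. Qed.

Lemma op_freeM p q v : op_free (p * q) v = op_free p (op_free q v).
Proof.
have sumw I (r : seq I) (F : I -> freealg) :
    op_free (\sum_(i <- r) F i) v = \sum_(i <- r) op_free (F i) v.
  by apply: (big_morph (op_free^~ v)) => [x y|]; rewrite ?op_freeD ?op_free0.
rewrite malgME sumw [in RHS]/op_free; apply: eq_bigr => w1 _.
rewrite sumw.
rewrite (big_morph (op_word w1) (op_wordD w1) (op_word0 w1)) scaler_sumr.
apply: eq_bigr => w2 _; rewrite op_freeU op_wordZ scalerA -polyCM.
by rewrite /op_word fmM foldr_cat.
Qed.

Lemma op_freeG g v : op_free (fgen k g) v = op_gen g v.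
Proof. by rewrite /fgen op_freeU scale1r /op_word fmU. Qed.

Lemma op_ideal p : Aideal p -> forall v, op_free p v = 0.
Proof.
apply: (smallest_sub
  (X := [set p : freealg | forall v, op_free p v = 0])); first split=> /=.
- exact: op_free0.
- by move=> u v hu hv w; rewrite op_freeD op_freeN hu hv subrr.
- by move=> r u hu w; rewrite op_freeM hu op_free_v0.
- by move=> r u hu w; rewrite op_freeM hu.
- move=> _ [[[n [a ->]]|[n [a ->]]]|[n [m [a [b ->]]]]] v;
    rewrite !(op_freeD, op_freeN, op_freeMn, op_freeM, op_freeG) /=.
  + by rewrite opL_del [X in X - _ - _]addrC addrK subrr.
  + by rewrite opR_del [X in X - _ - _]addrC addrK subrr.
  + by rewrite opRL subrr.
Qed.

Definition act (x : algA k Z) (v : V) : V := op_free (repr x) v.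

Lemma act_proj p v : act (Aproj p) v = op_free p v.
Proof.
apply/eqP; rewrite -subr_eq0 -op_freeN -op_freeD op_ideal //.
by apply/Aproj_eq; rewrite Aproj_repr.
Qed.

HB.instance Definition _ := GRing.Zmodule.copy (opmodule o) V.

Lemma actA x y v : act x (act y v) = act (x * y) v.
Proof.
by rewrite -(Aproj_repr x) -(Aproj_repr y) -rmorphM !act_proj op_freeM.
Qed.
Lemma act1 : left_id 1 act.
Proof. by move=> v; rewrite act_proj op_freeU scale1r /op_word fm1. Qed.
Lemma actDr : right_distributive act +%R.
Proof. by move=> x u v; exact: op_free_vD. Qed.
Lemma actDl v : {morph act^~ v : x y / x + y}.
Proof.
move=> x y; rewrite -(Aproj_repr x) -(Aproj_repr y) -raddfD !act_proj.
exact: op_freeD.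
Qed.
HB.instance Definition _ := GRing.Zmodule_isLmodule.Build (algA k Z) (opmodule o)
  actA act1 actDr actDl.

Lemma act_gen g v : act (Agen k g) v = op_gen g v.
Proof. by rewrite act_proj op_freeG. Qed.
End Act.
End Operators.

Notation "{ 'lpoly' V }" := {malg V[nat]}
  (at level 0, V at level 2, format "{ 'lpoly'  V }") : type_scope.

Section Lambda.
Context (k : fieldType).

(* The coefficient of lambda^n in lambda * p. *)
Definition lmulX (V : lmodType {poly k}) (p : {lpoly V}) (n : nat) : V :=
  if n is m.+1 then p@_m else 0.

(* The identities of a conformal action of [C] on [V], read off coefficient by
   coefficient; for [act = mul] these are those of an associative conformal
   algebra.  [conf_assoc] compares the coefficients of lambda^n mu^m in
     (a_(lambda) (b_(mu) v)) = ((a_(lambda) b)_(lambda + mu) v):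
   if w_(p,q) is the coefficient of nu^q in (((a_(lambda) b)@_p)_(nu) v), then
   the right-hand side is the sum of lambda^p (lambda + mu)^q w_(p,q). *)
Record is_conformal (C V : lmodType {poly k})
    (mul : C -> C -> {lpoly C}) (act : C -> V -> {lpoly V}) : Prop := {
  conf_linl : forall (c : k) (a b : C) (v : V) (n : nat),
    (act (c%:P *: a + b) v)@_n = c%:P *: (act a v)@_n + (act b v)@_n;
  conf_linr : forall (c : k) (a : C) (u v : V) (n : nat),
    (act a (c%:P *: u + v))@_n = c%:P *: (act a u)@_n + (act a v)@_n;
  conf_dell : forall (a : C) (v : V) (n : nat),
    (act ('X *: a) v)@_n = - lmulX (act a v) n;
  conf_delr : forall (a : C) (v : V) (n : nat),
    (act a ('X *: v))@_n = 'X *: (act a v)@_n + lmulX (act a v) n;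
  conf_assoc : forall (a b : C) (v : V) (n m : nat),
    (act a (act b v)@_m)@_n =
    \sum_(0 <= p < n.+1)
      (act (mul a b)@_p v)@_(n - p + m)%N *+ 'C(n - p + m, m)
}.

Record confAlg := ConfAlg {
  calg_sort :> lmodType {poly k};
  calg_mul : calg_sort -> calg_sort -> {lpoly calg_sort};
  calg_axioms : is_conformal calg_mul calg_mul
}.

Record confMod (C : confAlg) := ConfMod {
  cmod_sort :> lmodType {poly k};
  cmod_act : C -> cmod_sort -> {lpoly cmod_sort};
  cmod_axioms : is_conformal (@calg_mul C) cmod_act
}.

(* The coefficient of lambda^n in p(- lambda - d), with the powers of d acting
   on the coefficients of p. *)
Definition lflip (V : lmodType {poly k}) (p : {lpoly V}) (n : nat) : V :=
  \sum_(m <- msupp p) ((-1) ^+ m * 'X^(m - n) *+ 'C(m, n)) *: p@_m.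

End Lambda.

Section LambdaTheory.
Context (k : fieldType) (V : lmodType {poly k}).
Implicit Type p : {lpoly V}.

Lemma lpoly_bound p : exists K, forall m, (K <= m)%N -> p@_m = 0.
Proof.
exists (\max_(m <- msupp p) m.+1) => m hm; apply: mcoeff_outdom.
apply/negP => hin; move: hm; rewrite leqNgt.
by rewrite (@leq_bigmax_seq _ _ xpredT succn m).
Qed.

Lemma lflipEw p n K : (forall m, (K <= m)%N -> p@_m = 0) ->
  lflip p n = \sum_(0 <= m < K) ((-1) ^+ m * 'X^(m - n) *+ 'C(m, n)) *: p@_m.
Proof.
move=> hK; rewrite /lflip.
rewrite [RHS](bigID (fun m => m \in msupp p)) /= addrC.
rewrite [X in X + _]big1 ?add0r; last first.
  by move=> m hm; rewrite mcoeff_outdom // scaler0.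
rewrite -[RHS]big_filter; apply: perm_big; apply: uniq_perm.
- exact: fset_uniq.
- by rewrite filter_uniq // iota_uniq.
move=> m; rewrite mem_filter mem_index_iota /=.
case: (boolP (m \in msupp p)) => //= hm; apply/esym.
by rewrite ltnNge; apply/negP => /hK/eqP; rewrite mcoeff_eq0 hm.
Qed.

Lemma sum_shift (f : nat -> V) K c : (forall q, (K <= q)%N -> f q = 0) ->
  \sum_(0 <= q < K) f (q + c)%N =
  \sum_(0 <= q < K) (if (c <= q)%N then f q else 0).
Proof.
rewrite !big_mkord; elim: c f => [|c IH] f hf.
  by apply: eq_bigr => q _; rewrite addn0.
rewrite (eq_bigr (fun q : 'I_K => (f \o succn) (q + c)%N)); last first.
  by move=> q _; rewrite addnS.
rewrite IH => [|q hq]; last by rewrite /= hf // ltnW.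
transitivity (\sum_(q < K.+1) (if (c < q)%N then f q else 0)).
  by rewrite big_ord_recl /= add0r; apply: eq_bigr.
by rewrite big_ord_recr /= hf // if_same addr0.
Qed.

(* [bin3] and [alt_bin_sum] are the cancellation behind R_n^a L_m^b = L_m^b R_n^a
   on a conformal algebra. *)
Lemma bin3 (Q n d t : nat) : (t <= d)%N -> (d - t <= Q)%N ->
  ('C(Q - (d - t), n) * 'C(Q - (d - t) - n, t) * 'C(Q, d - t) =
  if (d + n <= Q)%N then 'C(d, t) * ('C(Q, n) * 'C(Q - n, d)) else 0)%N.
Proof.
move=> td hQ; case: leqP => h; last first.
  have [h1|h1] := ltnP (Q - (d - t)) n; first by rewrite bin_small.
  rewrite (@bin_small (_ - _ - _)) ?muln0 //; lia.
have [s ds] : exists s, d = (s + t)%N by exists (d - t)%N; rewrite subnK.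
have [r Qr] : exists r, Q = (r + d + n)%N.
  by exists (Q - (d + n))%N; rewrite -addnA subnK.
subst d Q.
rewrite (_ : (r + (s + t) + n - (s + t - t) = r + t + n)%N); last lia.
rewrite (_ : (r + t + n - n = r + t)%N); last lia.
rewrite (_ : (s + t - t = s)%N); last lia.
rewrite (_ : (r + (s + t) + n - n = r + (s + t))%N); last lia.
have e1 := @bin_fact (r + t + n) n (leq_addl _ _).
have e2 := @bin_fact (r + t) t (leq_addl _ _).
have hs : (s <= r + (s + t) + n)%N by lia.
have es : (r + (s + t) + n - s = r + t + n)%N by lia.
have e3 := bin_fact hs; rewrite es in e3.
have e4 := @bin_fact (s + t) t (leq_addl _ _).
have e5 := @bin_fact (r + (s + t) + n) n (leq_addl _ _).
have e6 := @bin_fact (r + (s + t)) (s + t) (leq_addl _ _).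
rewrite !addnK in e1 e2 e4 e5 e6.
have fpos : (0 < s`! * t`! * n`! * r`!)%N by rewrite !muln_gt0 !fact_gt0.
apply/eqP; rewrite -(eqn_pmul2r fpos); apply/eqP.
transitivity ((r + (s + t) + n)`!).
  rewrite -e3 -e1 -e2; ring.
rewrite -e5 -e6 -e4; ring.
Qed.
End LambdaTheory.

Lemma alt_bin_sum (R : comNzRingType) (Q n d m : nat) : (d <= m)%N ->
  \sum_(0 <= t < m.+1)
    (if (t <= d)%N && (d - t <= Q)%N then
       (-1) ^+ (Q - (d - t)) * 'X^(Q - (d - t) - n - t) *+
       ('C(Q - (d - t), n) * 'C(Q - (d - t) - n, t) * 'C(Q, d - t))
     else 0) =
  (if d == 0%N then (-1) ^+ Q * 'X^(Q - n) *+ 'C(Q, n) else 0) :> {poly R}.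
Proof.
move=> dm; rewrite (big_cat_nat (n := d.+1)) //=.
rewrite [X in _ + X]big_nat [X in _ + X]big1 ?addr0; last first.
  by move=> t /andP[dt _]; rewrite leqNgt dt.
rewrite (eq_big_nat _ _ (F2 := fun t => if (d + n <= Q)%N then
    ((-1) ^+ (Q - d) * 'X^(Q - d - n) *+ ('C(Q, n) * 'C(Q - n, d))) *
    (1 ^+ (d - t) * (-1) ^+ t *+ 'C(d, t)) else 0)); last first.
  move=> t /andP[_]; rewrite ltnS => td; rewrite td /=.
  case: (leqP (d - t) Q) => hQ; last by rewrite ifF //; lia.
  rewrite bin3 //; case: leqP => h; last by rewrite mulr0n.
  rewrite expr1n mul1r (_ : (Q - (d - t) - n - t = Q - d - n)%N); last lia.
  rewrite (_ : (Q - (d - t) = Q - d + t)%N); last lia.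
  rewrite exprD -mulrA -(commr_sign 'X^_ t).
  by rewrite mulrA mulrnAl mulrnAr -mulrnA mulnC.
case: leqP => h; last first.
  rewrite big1 //; case: eqP => // d0; rewrite bin_small ?mulr0n //; lia.
rewrite -mulr_sumr big_mkord -exprDn subrr.
case: eqP => [d0|/eqP d0]; last by rewrite expr0n (negPf d0) mulr0.
by rewrite d0 expr0 mulr1 !subn0 bin0 muln1.
Qed.

Section ConformalTheory.
Context (k : fieldType) (C V : lmodType {poly k}).
Context (mul : C -> C -> {lpoly C}) (act : C -> V -> {lpoly V}).
Hypothesis H : is_conformal mul act.

(* (a_(lambda) v) = sum_n lambda^n / n! L_n^a v *)
Definition Lop (a : C) (n : nat) (v : V) : V := (act a v)@_n *+ n`!.

Lemma Lop_lin a n (c : k) u v :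
  Lop a n (c%:P *: u + v) = c%:P *: Lop a n u + Lop a n v.
Proof. by rewrite /Lop (conf_linr H) mulrnDl scalerMnr. Qed.

Lemma Lop_del a n v : Lop a n ('X *: v) = 'X *: Lop a n v + Lop a n.-1 v *+ n.
Proof.
rewrite /Lop (conf_delr H) mulrnDl scalerMnr; congr (_ + _).
by case: n => [|n] /=; rewrite ?mulr0n ?mul0rn // factS mulnC mulrnA.
Qed.

Lemma conf0r a n : (act a 0)@_n = 0.
Proof.
have := conf_linr H (-1) a 0 0 n.
by rewrite scaler0 addr0 polyCN scaleN1r addNr.
Qed.
Lemma confDr a u v n : (act a (u + v))@_n = (act a u)@_n + (act a v)@_n.
Proof. by have := conf_linr H 1 a u v n; rewrite !scale1r. Qed.
Lemma confZr (c : k) a v n : (act a (c%:P *: v))@_n = c%:P *: (act a v)@_n.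
Proof. by have := conf_linr H c a v 0 n; rewrite conf0r !addr0. Qed.

Lemma conf_Xn s b v m : (act b ('X^s *: v))@_m =
  \sum_(t < m.+1) ('X^(s - t) *+ 'C(s, t)) *: (act b v)@_(m - t)%N.
Proof.
elim: s m => [|s IH] m.
  rewrite big_ord_recl big1 => [|i _]; last by rewrite mulr0n scale0r.
  by rewrite expr0 mulr1n !scale1r addr0 subn0.
rewrite exprS -scalerA (conf_delr H) IH.
rewrite big_ord_recl [RHS]big_ord_recl /= !bin0 !subn0 !mulr1n scalerDr.
rewrite scalerA -exprS -addrA; congr (_ + _).
have -> : lmulX (act b ('X^s *: v)) m =
  \sum_(t < m) ('X^(s - t) *+ 'C(s, t)) *: (act b v)@_(m - t.+1)%N.
  by case: m => [|m]; rewrite ?big_ord0 //= IH.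
rewrite scaler_sumr -big_split; apply: eq_bigr => t _ /=.
rewrite /bump /= add1n binS mulrnDr scalerDl subSS; congr (_ + _).
rewrite scalerA mulrnAr -exprS; have [st|ts] := leqP s t.
  by rewrite bin_small // !mulr0n.
by rewrite -subSn // subSS.
Qed.

Lemma conf_flip b (p : {lpoly V}) n m K : (forall q, (K <= q)%N -> p@_q = 0) ->
  (act b (lflip p n))@_m = \sum_(0 <= q < K) \sum_(0 <= t < m.+1)
    ((-1) ^+ q * 'X^(q - n - t) *+ ('C(q, n) * 'C(q - n, t)))
      *: (act b p@_q)@_(m - t)%N.
Proof.
move=> hK; rewrite (lflipEw _ hK).
rewrite (big_morph (fun v => (act b v)@_m) (fun u v => confDr b u v m)
  (conf0r b m)); apply: eq_bigr => q _.
have -> : (-1) ^+ q * 'X^(q - n) *+ 'C(q, n) =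
    ((-1) ^+ q *+ 'C(q, n))%:P * 'X^(q - n) :> {poly k}.
  by rewrite polyCMn rmorphXn /= polyCN mulrnAl.
rewrite -scalerA confZr conf_Xn scaler_sumr big_mkord.
apply: eq_bigr => t _; rewrite scalerA; congr (_ *: _).
by rewrite polyCMn rmorphXn /= polyCN mulrnAl !mulrnAr -mulrnA mulnC.
Qed.
End ConformalTheory.

Section RLcommute.
Context (k : fieldType) (C : confAlg k).
Local Notation mul := (@calg_mul k C).
Let H := @calg_axioms k C.

(* (u_(- lambda - d) a) = sum_n lambda^n / n! R_n^a u *)
Definition Rop (a : C) (n : nat) (u : C) : C := lflip (mul u a) n *+ n`!.

Lemma conf_bound (f : nat -> {lpoly C}) m :
  exists K, forall p q, (p <= m)%N -> (K <= q)%N -> (f p)@_q = 0.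
Proof.
elim: m => [|m [K hK]].
  by have [K hK] := lpoly_bound (f 0%N); exists K => -[|//] q _; exact: hK.
have [K' hK'] := lpoly_bound (f m.+1); exists (maxn K K') => p q.
rewrite geq_max leq_eqVlt => /orP[/eqP-> /andP[_]|pm /andP[hq _]].
  exact: hK'.
exact: hK.
Qed.

Lemma lflip_mul a b u n m :
  lflip (mul (mul b u)@_m a) n = (mul b (lflip (mul u a) n))@_m.
Proof.
pose E p Q := (mul (mul b u)@_p a)@_Q.
have [K1 hK1] := conf_bound (fun p => mul (mul b u)@_p a) m.
have [K2 hK2] := lpoly_bound (mul u a).
pose K := maxn K1 K2.
have hE p Q : (p <= m)%N -> (K <= Q)%N -> E p Q = 0.
  by move=> pm; rewrite geq_max => /andP[h _]; exact: hK1.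
have hK q : (K <= q)%N -> (mul u a)@_q = 0.
  by rewrite geq_max => /andP[_ h]; exact: hK2.
rewrite (lflipEw _ (fun Q => @hE m Q (leqnn m))) (conf_flip H _ _ _ hK).
pose g d t Q : {poly k} := if (t <= d)%N && (d - t <= Q)%N then
  (-1) ^+ (Q - (d - t)) * 'X^(Q - (d - t) - n - t) *+
  ('C(Q - (d - t), n) * 'C(Q - (d - t) - n, t) * 'C(Q, d - t)) else 0.
transitivity (\sum_(0 <= p < m.+1) \sum_(0 <= t < m.+1) \sum_(0 <= Q < K)
  g (m - p)%N t Q *: E p Q).
  rewrite big_nat_recr //= [X in _ = X + _]big_nat [X in _ = X + _]big1 => [|p].
    rewrite add0r exchange_big /=; apply: eq_bigr => Q _.
    by rewrite -scaler_suml alt_bin_sum subnn.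
  move=> /andP[_ pm]; rewrite exchange_big big1 // => Q _.
  rewrite -scaler_suml alt_bin_sum ?leq_subr // ifF ?scale0r //.
  by apply/negbTE; rewrite -lt0n subn_gt0.
apply/esym; transitivity (\sum_(0 <= q < K) \sum_(0 <= t < m.+1)
    \sum_(0 <= p < m.+1) if (p <= m)%N && (t <= m - p)%N then
      ((-1) ^+ q * 'X^(q - n - t) *+
       ('C(q, n) * 'C(q - n, t) * 'C(q + (m - p - t), m - p - t)))
      *: E p (q + (m - p - t))%N else 0).
  apply: eq_bigr => q _; apply: eq_big_nat => t /andP[_ tm].
  rewrite (conf_assoc H) scaler_sumr.
  rewrite (big_nat_widen _ _ m.+1) ?ltnS ?leq_subr // big_mkcond /=.
  apply: eq_big_nat => p /andP[_ pm]; rewrite ltnS in pm.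
  rewrite ltnS pm /= (_ : (p <= m - t)%N = (t <= m - p)%N); last lia.
  case: ifP => // h; rewrite (_ : (m - t - p + q = q + (m - p - t))%N); last lia.
  have -> : 'C(q + (m - p - t), q) = 'C(q + (m - p - t), m - p - t).
    by rewrite -[RHS]bin_sub ?leq_addl // addnK.
  by rewrite -scalerMnr scalerMnl -mulrnA.
rewrite exchange_big /= [LHS](eq_bigr _ (fun t _ => exchange_big _ _ _ _ _ _)).
rewrite /= exchange_big /=; apply: eq_big_nat => p /andP[_ pm].
rewrite ltnS in pm; apply: eq_bigr => t _; rewrite pm /=.
case: (leqP t (m - p)) => ht; last first.
  by rewrite !big1 // => Q _; rewrite /g leqNgt ht /= scale0r.
pose f Q := ((-1) ^+ (Q - (m - p - t)) * 'X^(Q - (m - p - t) - n - t) *+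
  ('C(Q - (m - p - t), n) * 'C(Q - (m - p - t) - n, t) * 'C(Q, m - p - t)))
  *: E p Q.
transitivity (\sum_(0 <= q < K) f (q + (m - p - t))%N).
  by apply: eq_bigr => q _; rewrite /f addnK.
rewrite sum_shift => [|q hq]; last by rewrite /f hE // scaler0.
by apply: eq_bigr => Q _; rewrite /g /f ht /=; case: ifP; rewrite ?scale0r.
Qed.

Lemma lflip_lin a n (c : k) u v : lflip (mul (c%:P *: u + v) a) n =
  c%:P *: lflip (mul u a) n + lflip (mul v a) n.
Proof.
have [K hK] := conf_bound (fun i => nth (mul u a)
  [:: mul u a; mul v a; mul (c%:P *: u + v) a] i) 2.
rewrite (lflipEw n (hK 0%N ^~ isT)) (lflipEw n (hK 1%N ^~ isT)).
rewrite (lflipEw n (hK 2%N ^~ isT)) scaler_sumr -big_split.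
apply: eq_bigr => m _ /=; rewrite (conf_linl H) scalerDr !scalerA.
by rewrite [c%:P * _]mulrC.
Qed.

Lemma lflip_del a n u : lflip (mul ('X *: u) a) n =
  'X *: lflip (mul u a) n + (if n is i.+1 then lflip (mul u a) i else 0).
Proof.
have [K hK] := lpoly_bound (mul u a).
have hK' m : (K.+1 <= m)%N -> (mul ('X *: u) a)@_m = 0.
  by rewrite (conf_dell H); case: m => //= m /hK ->; rewrite oppr0.
rewrite (lflipEw n hK') big_nat_recl // (conf_dell H) /= oppr0 scaler0 add0r.
have -> : (if n is i.+1 then lflip (mul u a) i else 0) = \sum_(0 <= m < K)
    (if n is i.+1 then ((-1) ^+ m * 'X^(m - i) *+ 'C(m, i)) *: (mul u a)@_m
     else 0).
  by case: n => [|n]; [rewrite big1|exact: lflipEw].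
rewrite (lflipEw n hK) scaler_sumr -big_split; apply: eq_bigr => m _ /=.
rewrite (conf_dell H) /= scalerA scalerN -scaleNr mulrnAr.
rewrite exprS mulN1r mulNr mulNrn opprK.
case: n => [|n].
  by rewrite !bin0 !subn0 addr0 exprS mulrCA.
rewrite binS mulrnDr scalerDl subSS; congr (_ *: _ + _).
have [mn|nm] := leqP m n; first by rewrite bin_small // !mulr0n.
by rewrite mulrCA -exprS -subSn // subSS.
Qed.

Lemma Rop_lin a n (c : k) u v :
  Rop a n (c%:P *: u + v) = c%:P *: Rop a n u + Rop a n v.
Proof. by rewrite /Rop lflip_lin mulrnDl scalerMnr. Qed.

Lemma Rop_del a n u : Rop a n ('X *: u) = 'X *: Rop a n u + Rop a n.-1 u *+ n.
Proof.
rewrite /Rop lflip_del mulrnDl scalerMnr; congr (_ + _).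
by case: n => [|n] /=; rewrite ?mulr0n ?mul0rn // factS mulnC mulrnA.
Qed.

Lemma confMnr b v i n : (mul b (v *+ i))@_n = (mul b v)@_n *+ i.
Proof.
by elim: i => [|i IH]; rewrite ?mulr0n ?(conf0r H) // !mulrS (confDr H) IH.
Qed.

Lemma lflipMn a u i n : lflip (mul (u *+ i) a) n = lflip (mul u a) n *+ i.
Proof.
have h0 : lflip (mul 0 a) n = 0.
  by have := lflip_lin a n (-1) 0 0; rewrite scaler0 addr0 polyCN scaleN1r addNr.
elim: i => [|i IH]; rewrite ?mulr0n // !mulrS -IH.
by have := lflip_lin a n 1 u (u *+ i); rewrite !scale1r.
Qed.

Lemma Rop_Lop n m a b u :
  Rop a n (Lop mul b m u) = Lop mul b m (Rop a n u).
Proof. by rewrite /Rop /Lop lflipMn confMnr lflip_mul mulrnAC. Qed.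
End RLcommute.

Section AlgebraMap.
Context (k : fieldType) (X Z : choiceType) (f : X -> Z).

Definition gen_map (g : gen X) : gen Z :=
  match g with
  | GD => GD | GL n a => GL n (f a) | GR n a => GR n (f a)
  end.

Definition word_map (w : {fmonom gen X}) : {malg k[{fmonom gen Z}]} :=
  \prod_(g <- w) fgen k (gen_map g).

Lemma word_map_mmorphism : mmorphism word_map.
Proof.
split=> [u v|]; first by rewrite /word_map fmM big_cat.
by rewrite /word_map fm1 big_nil.
Qed.
HB.instance Definition _ := isMultiplicative.Build {fmonom gen X}
  {malg k[{fmonom gen Z}]} word_map word_map_mmorphism.

Definition free_map : {malg k[{fmonom gen X}]} -> {malg k[{fmonom gen Z}]} :=
  mmap (@mkmalgU _ k mone) word_map.

Definition Amap (x : algA k X) : algA k Z := Aproj (free_map (repr x)).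

Lemma free_map_monoid_morphism : monoid_morphism free_map.
Proof.
have [hM h1] := @commr_mmap_is_multiplicative _ _ _ (@mkmalgU _ k mone) word_map
  (fun g m m' => malgC_central _ _).
by split.
Qed.

Lemma free_map_zmod_morphism : zmod_morphism free_map.
Proof. exact: mmap_is_additive. Qed.
HB.instance Definition _ := GRing.isZmodMorphism.Build
  {malg k[{fmonom gen X}]} {malg k[{fmonom gen Z}]} free_map
  free_map_zmod_morphism.
HB.instance Definition _ := GRing.isMonoidMorphism.Build
  {malg k[{fmonom gen X}]} {malg k[{fmonom gen Z}]} free_map
  free_map_monoid_morphism.

Lemma free_map_gen g : free_map (fgen k g) = fgen k (gen_map g).
Proof.
rewrite /free_map /fgen mmapU /= /word_map fmU big_seq1.
exact: mul1r.
Qed.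

Lemma free_map_ideal p : Aideal p -> Aideal (free_map p).
Proof.
have [i0 iB il ir] := @Aideal_is_ideal k Z.
have f0 : free_map 0 = 0 := raddf0 free_map.
have fB p1 q1 : free_map (p1 - q1) = free_map p1 - free_map q1.
  exact: free_map_zmod_morphism.
have fM p1 q1 : free_map (p1 * q1) = free_map p1 * free_map q1.
  exact: free_map_monoid_morphism.2.
have fn p1 n : free_map (p1 *+ n) = free_map p1 *+ n by exact: raddfMn.
have fg g1 g2 : free_map (fgen k g1 * fgen k g2) =
    fgen k (gen_map g1) * fgen k (gen_map g2).
  by rewrite -!free_map_gen; exact: fM.
apply: (smallest_sub (X := [set p | Aideal (free_map p)])); first split=> /=.
- exact: (eq_ind_r (@Aideal k Z) i0 f0).
- by move=> p1 q1 hp hq; apply: (eq_ind_r (@Aideal k Z) _ (fB _ _)); exact: iB.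
- by move=> r p1 hp; apply: (eq_ind_r (@Aideal k Z) _ (fM _ _)); exact: il.
- by move=> r p1 hp; apply: (eq_ind_r (@Aideal k Z) _ (fM _ _)); exact: ir.
have rel_del g1 g2 g3 n : free_map
    (fgen k g1 * fgen k g2 - fgen k g2 * fgen k g1 - fgen k g3 *+ n) =
    fgen k (gen_map g1) * fgen k (gen_map g2)
    - fgen k (gen_map g2) * fgen k (gen_map g1) - fgen k (gen_map g3) *+ n.
  apply: etrans (fB _ _) _; congr (_ - _).
    by apply: etrans (fB _ _) _; congr (_ - _); exact: fg.
  by apply: etrans (fn _ _) _; congr (_ *+ n); exact: free_map_gen.
move=> _ [[[n [a ->]]|[n [a ->]]]|[n [m [a [b ->]]]]] /=.
- apply: (eq_ind_r (@Aideal k Z) _ (rel_del _ _ _ _)).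
  by apply: sub_gen_smallest; left; left; exists n, (f a).
- apply: (eq_ind_r (@Aideal k Z) _ (rel_del _ _ _ _)).
  by apply: sub_gen_smallest; left; right; exists n, (f a).
- apply: (eq_ind_r (@Aideal k Z) _ (fB _ _)).
  apply: (eq_ind_r (fun q => @Aideal k Z (q - _)) _ (fg _ _)).
  apply: (eq_ind_r (fun q => @Aideal k Z (_ - q)) _ (fg _ _)).
  by apply: sub_gen_smallest; right; exists n, m, (f a), (f b).
Qed.

Lemma Amap_proj p : Amap (Aproj p) = Aproj (free_map p).
Proof.
apply/Aproj_eq; rewrite -raddfB; apply: free_map_ideal.
by apply/Aproj_eq; rewrite Aproj_repr.
Qed.

Lemma Amap_monoid_morphism : monoid_morphism Amap.
Proof.
split=> [|x y]; first by rewrite Amap_proj rmorph1.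
by rewrite -(Aproj_repr x) -(Aproj_repr y) -rmorphM !Amap_proj !rmorphM.
Qed.
Lemma Amap_zmod_morphism : zmod_morphism Amap.
Proof.
move=> x y; rewrite -(Aproj_repr x) -(Aproj_repr y) -raddfB !Amap_proj.
by rewrite -raddfB -raddfB.
Qed.
HB.instance Definition _ := GRing.isZmodMorphism.Build
  (algA k X) (algA k Z) Amap Amap_zmod_morphism.
HB.instance Definition _ := GRing.isMonoidMorphism.Build
  (algA k X) (algA k Z) Amap Amap_monoid_morphism.

Lemma Amap_gen g : Amap (Agen k g) = Agen k (gen_map g).
Proof. by rewrite Amap_proj free_map_gen. Qed.
End AlgebraMap.

Definition freemod (k : fieldType) (Z W : choiceType) :=
  {malg (algA k Z)[W]}.

Definition fbasis (k : fieldType) (Z W : choiceType) (w : W) : freemod k Z W :=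
  << 1 *g w >>.

(* The map A(X) (x) kY -> A(Z) (x) kW induced by f : X -> Z and g : Y -> W. *)
Definition freemod_map (k : fieldType) (X Y Z W : choiceType)
    (f : X -> Z) (g : Y -> W) (u : freemod k X Y) : freemod k Z W :=
  \sum_(y <- msupp u) Amap f (u@_y) *: fbasis k Z (g y).

Definition freemod_eval (k : fieldType) (Z W : choiceType)
    (V : lmodType (algA k Z)) (j : W -> V) (u : freemod k Z W) : V :=
  \sum_(w <- msupp u) u@_w *: j w.

Section ModuleM.
Context (k : fieldType) (Z : choiceType) (N : Z -> Z -> nat).

Local Notation del := (Agen k (@GD Z)).
Local Notation L n a := (Agen k (GL n a)).
Local Notation R n a := (Agen k (GR n a)).

(* In the second family the upper bound s <= N(a,b) - m of the sum is an
   inequality between integers: there are no terms when m > N(a,b), in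
   agreement with the truncated [(N a b).+1 - m]. *)
Definition Mrel : set (freemod k Z Z) :=
  [set u | exists (a b : Z) (n : nat),
     (N a b <= n)%N /\ u = L n a *: fbasis k Z b]
  `|`
  [set u | exists (a b : Z) (m : nat), u = R m b *: fbasis k Z a -
     \sum_(s < (N a b).+1 - m)
        ((((-1) ^+ (m + s) / (s`!)%:R : k) *: (del ^+ s * L (m + s)%N a))
          *: fbasis k Z b)].

Definition modM := quotmod Mrel.

Definition Mproj : freemod k Z Z -> modM := @qproj _ _ Mrel.

(* The quotient of M(Z,N) by the A(Z)-submodule generated by the image of S. *)
Definition presM (S : set (freemod k Z Z)) := quotmod (Mproj @` S).

Definition presM_gen (S : set (freemod k Z Z)) (z : Z) : presM S :=
  qproj (Mproj @` S) (Mproj (fbasis k Z z)).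
End ModuleM.

Section Presentations.
Context (k : fieldType).

Definition alg_ops (C : confAlg k) (Z : choiceType) (i : Z -> C) : ops Z C :=
  @Ops k Z C
    (fun n a => Lop (@calg_mul k C) (i a) n) (fun n a => Rop (i a) n)
    (fun n a => Lop_lin (calg_axioms C) (i a) n)
    (fun n a => Rop_lin (i a) n)
    (fun n a => Lop_del (calg_axioms C) (i a) n)
    (fun n a => Rop_del (i a) n)
    (fun n m a b => Rop_Lop n m (i a) (i b)).

(* On a left conformal module the operators R_n^x act as zero. *)
Definition mod_ops (C : confAlg k) (M : confMod C) (X : choiceType)
  (i : X -> C) : ops X M.
Proof.
apply: (@Ops k X M (fun n a => Lop (@cmod_act k C M) (i a) n)
  (fun _ _ _ => 0)).
- by move=> n a; exact: (Lop_lin (cmod_axioms M)).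
- by move=> *; rewrite scaler0 addr0.
- by move=> n a; exact: (Lop_del (cmod_axioms M)).
- by move=> *; rewrite scaler0 add0r mul0rn.
- move=> n m a b v; have := Lop_lin (cmod_axioms M) (i b) m (-1) 0 0.
  by rewrite scaler0 addr0 polyCN scaleN1r addNr => ->.
Defined.

Definition is_conf_subalg (C : confAlg k) (P : set C) : Prop :=
  is_submod P /\
  forall (a b : C) (n : nat), P a -> P b -> P ((calg_mul a b)@_n).

Definition is_conf_submod (C : confAlg k) (M : confMod C) (P : set M) : Prop :=
  is_submod P /\
  forall (a : C) (v : M) (n : nat), P v -> P ((cmod_act a v)@_n).

(* [C] is generated by [i] relative to the locality function [N], with defining
   relations [S].  The isomorphism is the canonical one: it matches the
   generators. *)
Definition conf_alg_presented (C : confAlg k) (Z : choiceType) (i : Z -> C)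
    (N : Z -> Z -> nat) (S : set (freemod k Z Z)) : Prop :=
  [/\ smallest (@is_conf_subalg C) (range i) = setT,
      forall (a b : Z) (n : nat),
        (N a b <= n)%N -> (calg_mul (i a) (i b))@_n = 0
    & exists f : {linear presM N S -> opmodule (alg_ops i)},
        bijective f /\ forall z : Z, f (presM_gen N S z) = i z].

Definition satisfies (C : confAlg k) (X Y : choiceType) (i : X -> C)
    (M : confMod C) (j : Y -> M) (N' : X -> Y -> nat)
    (T : set (freemod k X Y)) : Prop :=
  (forall (x : X) (y : Y) (n : nat),
     (N' x y <= n)%N -> (cmod_act (i x) (j y))@_n = 0) /\
  (forall t, T t -> freemod_eval (j : Y -> opmodule (mod_ops M i)) t = 0).

Definition is_conf_hom (C : confAlg k) (M M' : confMod C)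
    (f : {linear M -> M'}) : Prop :=
  forall (a : C) (v : M) (n : nat),
    f ((cmod_act a v)@_n) = (cmod_act a (f v))@_n.

Definition conf_mod_presented (C : confAlg k) (X Y : choiceType) (i : X -> C)
    (M : confMod C) (j : Y -> M) (N' : X -> Y -> nat)
    (T : set (freemod k X Y)) : Prop :=
  [/\ smallest (@is_conf_submod C M) (range j) = setT,
      satisfies i j N' T
    & forall (M' : confMod C) (j' : Y -> M'), satisfies i j' N' T ->
        exists f : {linear M -> M'},
          [/\ is_conf_hom f, f \o j =1 j'
            & forall g : {linear M -> M'},
                is_conf_hom g -> g \o j =1 j' -> g =1 f]].

End Presentations.

Section SplitNull.
Context (k : fieldType) (C : confAlg k) (M : confMod C).

(* ((a, u)_(lambda) (b, v)) = ((a_(lambda) b), (a_(lambda) v)) *)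
Definition snull_mul (x y : C * M) : {lpoly (C * M)%type} :=
  [malg n in (msupp (calg_mul x.1 y.1) `|` msupp (cmod_act x.1 y.2))%fset =>
     ((calg_mul x.1 y.1)@_n, (cmod_act x.1 y.2)@_n)].

Lemma snull_mulE x y n :
  (snull_mul x y)@_n = ((calg_mul x.1 y.1)@_n, (cmod_act x.1 y.2)@_n).
Proof.
rewrite mcoeffE in_fsetU; case: ifP => // /norP[h1 h2].
by rewrite !mcoeff_outdom.
Qed.

Lemma snull_conformal : @is_conformal k (C * M)%type (C * M)%type
  snull_mul snull_mul.
Proof.
have HC := calg_axioms C; have HM := cmod_axioms M.
have sh x y n : lmulX (snull_mul x y) n =
    (lmulX (calg_mul x.1 y.1) n, lmulX (cmod_act x.1 y.2) n).
  by case: n => //= n; rewrite snull_mulE.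
split.
- move=> c a b v n; rewrite !snull_mulE /=.
  by rewrite (conf_linl HC) (conf_linl HM).
- move=> c a u v n; rewrite !snull_mulE /=.
  by rewrite (conf_linr HC) (conf_linr HM).
- by move=> a v n; rewrite sh !snull_mulE /= (conf_dell HC) (conf_dell HM).
- by move=> a v n; rewrite sh !snull_mulE /= (conf_delr HC) (conf_delr HM).
- move=> a b v n m; rewrite !snull_mulE /= (conf_assoc HC) (conf_assoc HM).
  apply/esym; rewrite [LHS]surjective_pairing; congr pair;
  rewrite raddf_sum; apply: eq_bigr => p _;
  by rewrite raddfMn /= !snull_mulE.
Qed.

Definition snull : confAlg k :=
  @ConfAlg k (C * M)%type snull_mul snull_conformal.

End SplitNull.

Section SumData.
Context (X Y : choiceType).

(* The disjoint union of X and Y is the sum type. *)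
Definition snull_gen (k : fieldType) (C : confAlg k) (M : confMod C)
    (i : X -> C) (j : Y -> M) (z : X + Y) : snull M :=
  match z with inl x => (i x, 0) | inr y => (0, j y) end.

Definition snull_loc (N : X -> X -> nat) (N' : X -> Y -> nat)
    (z w : X + Y) : nat :=
  match z, w with
  | inl x, inl x' => N x x'
  | inl x, inr y => N' x y
  | inr _, _ => 0%N
  end.

Definition snull_rel (k : fieldType) (S : set (freemod k X X))
    (T : set (freemod k X Y)) : set (freemod k (X + Y)%type (X + Y)%type) :=
  (freemod_map inl inl @` S) `|` (freemod_map inl inr @` T) `|`
  [set w | exists (y : Y) (n : nat) (u : freemod k (X + Y)%type (X + Y)%type),
     w = Agen k (GL n (inr y)) *: u].
End SumData.

(* Main.v *)
(* On C + M the operators L_n^y vanish and, M being a left module, so do the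
   R_n^x on M: hence all the listed elements are relations of C + M, and the
   quotient E of M(X + Y, N) maps onto C + M.  For injectivity, the relations S
   give an A(X)-linear map g : C -> E, and E is spanned over H = k[d] by g(C),
   Y and the R_m^y g(C); the latter are the values (c_(n) y) up to the flip
   lambda |-> - lambda - d.  The point is to make E a conformal C-module in which
   (x_(lambda) u) = sum_n lambda^n / n! L_n^x u: since R_m^y commutes with L_n^x,
   the action of c in C has to be g(v) |-> g(c_(lambda) v),
   R_m^y g(v) |-> R_m^y g(c_(lambda) v), y |-> (R^y_(- lambda - d)) g(c), which
   determines it, and it exists because the c for which it exists form a
   conformal subalgebra of C containing X.  The universal property of M then
   gives M -> E, and C + M -> E is onto and a section of E -> C + M.
   The lambda-polynomials are handled through their values at lambda in k, for
   which associativity reads a_(s) (b_(t) v) = (a_(s) b)_(s + t) v, without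
   binomial coefficients. *)
Require Import Defs.
From HB Require Import structures.
From mathcomp Require Import all_boot all_algebra.
From mathcomp Require Import finmap zify ring.
From mathcomp Require Import boolp classical_sets.
From mathcomp.multinomials Require Import monalg.

Set Implicit Arguments.
Unset Strict Implicit.
Unset Printing Implicit Defensive.

Import GRing.Theory.

Local Open Scope classical_set_scope.
Local Open Scope ring_scope.

(** * Closure properties of submodules *)

Lemma pairP (A B : Type) (u v : A * B) : u.1 = v.1 -> u.2 = v.2 -> u = v.
Proof. by case: u v => [a b] [a' b'] /= -> ->. Qed.

Lemma submod0 (A : pzRingType) (V : lmodType A) (P : set V) :
  is_submod P -> P 0.
Proof. by case. Qed.

Lemma submodD (A : pzRingType) (V : lmodType A) (P : set V) u v :
  is_submod P -> P u -> P v -> P (u + v).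
Proof. by move=> [_ h] hu hv; rewrite -[u]scale1r; apply: h. Qed.

Lemma submodZ (A : pzRingType) (V : lmodType A) (P : set V) a v :
  is_submod P -> P v -> P (a *: v).
Proof. by move=> [h0 h] hv; rewrite -[_ *: _]addr0; apply: h. Qed.

Lemma submodB (A : pzRingType) (V : lmodType A) (P : set V) u v :
  is_submod P -> P u -> P v -> P (u - v).
Proof.
by move=> HP hu hv; apply: submodD => //; rewrite -scaleN1r; apply: submodZ.
Qed.

Lemma submodMn (A : pzRingType) (V : lmodType A) (P : set V) v n :
  is_submod P -> P v -> P (v *+ n).
Proof. by move=> HP hv; rewrite -scaler_nat; apply: submodZ. Qed.

Lemma submod_sum (A : pzRingType) (V : lmodType A) (P : set V) :
  is_submod P -> forall I (r : seq I) (Q : pred I) (F : I -> V),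
  (forall i, Q i -> P (F i)) -> P (\sum_(i <- r | Q i) F i).
Proof.
move=> HP I r Q F hF; apply: (big_ind P) => //; first exact: submod0.
by move=> u v; apply: submodD.
Qed.

(** H = k[d] is generated by the constants and d, so stability under both propagates to every
    polynomial along its Horner form. *)
Lemma submod_poly (k : fieldType) (V : lmodType {poly k}) (P : set V) : P 0 ->
  (forall u v, P u -> P v -> P (u + v)) ->
  (forall (c : k) v, P v -> P (c%:P *: v)) -> (forall v, P v -> P ('X *: v)) ->
  is_submod P.
Proof.
move=> h0 hD hc hX; split=> // p u v hu hv; apply: (hD) => //.
elim/poly_ind: p => [|p c IH]; first by rewrite scale0r.
by rewrite scalerDl mulrC -scalerA; apply: hD; [exact: hX|exact: hc].
Qed.

(** * Values of lambda-polynomials *)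

Section Evaluation.
Context (k : fieldType).
Implicit Types V : lmodType {poly k}.

(* The scalar values h = c%:P recover p because k is infinite, and h = - c - d
   gives the flip lambda |-> - lambda - d. *)
Definition hev V (h : {poly k}) (p : {lpoly V}) : V :=
  \sum_(n <- msupp p) h ^+ n *: p@_n.

Lemma hevEw V (h : {poly k}) (p : {lpoly V}) K :
  (forall m, (K <= m)%N -> p@_m = 0) ->
  hev h p = \sum_(0 <= n < K) h ^+ n *: p@_n.
Proof.
move=> hK; rewrite /hev.
rewrite [RHS](bigID (fun m => m \in msupp p)) /= addrC.
rewrite [X in X + _]big1 ?add0r; last first.
  by move=> m hm; rewrite mcoeff_outdom // scaler0.
rewrite -[RHS]big_filter; apply: perm_big; apply: uniq_perm.
- exact: fset_uniq.
- by rewrite filter_uniq // iota_uniq.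
move=> m; rewrite mem_filter mem_index_iota /=.
case: (boolP (m \in msupp p)) => //= hm; apply/esym.
by rewrite ltnNge; apply/negP => /hK/eqP; rewrite mcoeff_eq0 hm.
Qed.

Lemma mk_lpoly V (v : nat -> V) K :
  exists p : {lpoly V}, forall n, p@_n = if (n < K)%N then v n else 0.
Proof.
elim: K => [|K [p hp]]; first by exists 0 => n; rewrite mcoeff0.
exists (p + << v K *g K >>) => n; rewrite mcoeffD hp mcoeffU ltnS.
by case: (ltngtP n K) => [_|_|->]; rewrite ?mulr0n ?addr0 ?mulr1n ?add0r.
Qed.

Lemma mk_lpoly0 V (v : nat -> V) K : (forall n, (K <= n)%N -> v n = 0) ->
  exists p : {lpoly V}, forall n, p@_n = v n.
Proof.
move=> hK; have [p hp] := mk_lpoly v K; exists p => n.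
by rewrite hp; case: ltnP => // /hK.
Qed.

Lemma lmulX_lpoly V (p : {lpoly V}) :
  exists q : {lpoly V}, forall n, q@_n = lmulX p n.
Proof.
have [K hK] := lpoly_bound p.
by apply: (@mk_lpoly0 _ _ K.+1) => -[|n] //= /hK->.
Qed.

Lemma lpoly_bound2 V V' (p : {lpoly V}) (q : {lpoly V'}) :
  exists K, forall m, (K <= m)%N -> p@_m = 0 /\ q@_m = 0.
Proof.
have [K hK] := lpoly_bound p; have [K' hK'] := lpoly_bound q.
exists (maxn K K') => m; rewrite geq_max => /andP[h h'].
by split; [exact: hK|exact: hK'].
Qed.

Lemma lpoly_bounds V (f : nat -> {lpoly V}) m :
  exists K, forall p q, (p < m)%N -> (K <= q)%N -> (f p)@_q = 0.
Proof.
elim: m => [|m [K hK]]; first by exists 0%N.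
have [K' hK'] := lpoly_bound (f m); exists (maxn K K') => p q.
rewrite geq_max ltnS leq_eqVlt => /orP[/eqP-> /andP[_]|pm /andP[hq _]].
  exact: hK'.
exact: hK.
Qed.

(** [h] and [h'] may differ because [F] need not be H-linear: a map c_(a) turns d into d + a, hence
    moves the point of evaluation when that point involves d. *)
Lemma hev_map V V' (F : V -> V') h h' (p : {lpoly V}) (q : {lpoly V'}) :
    F 0 = 0 -> {morph F : u v / u + v} ->
    (forall n v, F (h ^+ n *: v) = h' ^+ n *: F v) ->
    (forall n, q@_n = F p@_n) ->
  F (hev h p) = hev h' q.
Proof.
move=> F0 FD FZ hq; have [K hK] := lpoly_bound2 p q.
rewrite (hevEw _ (fun m l => (hK m l).1)) (hevEw _ (fun m l => (hK m l).2)).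
by rewrite (big_morph F FD F0); apply: eq_bigr => n _; rewrite hq FZ.
Qed.

Lemma hev_lin V h c (p q r : {lpoly V}) :
    (forall n, r@_n = c *: p@_n + q@_n) ->
  hev h r = c *: hev h p + hev h q.
Proof.
move=> hr; have [K hK] := lpoly_bound2 p q.
have hK' m : (K <= m)%N -> r@_m = 0.
  by move=> /hK[e1 e2]; rewrite hr e1 e2 scaler0 addr0.
rewrite (hevEw _ hK') (hevEw _ (fun m l => (hK m l).1)).
rewrite (hevEw _ (fun m l => (hK m l).2)) scaler_sumr -big_split.
by apply: eq_bigr => n _; rewrite hr scalerDr !scalerA mulrC.
Qed.

Lemma hev0 V h (p : {lpoly V}) : (forall n, p@_n = 0) -> hev h p = 0.
Proof.
by move=> hp; rewrite /hev big1 // => n _; rewrite hp scaler0.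
Qed.

Lemma hevD V h (p q : {lpoly V}) : hev h (p + q) = hev h p + hev h q.
Proof.
by rewrite -[hev h p]scale1r; apply: hev_lin => n; rewrite mcoeffD scale1r.
Qed.

Lemma hevZ V h c (p q : {lpoly V}) : (forall n, q@_n = c *: p@_n) ->
  hev h q = c *: hev h p.
Proof.
move=> hq; rewrite -[RHS]addr0 -(@hev0 V h 0) => [|n]; last exact: mcoeff0.
by apply: hev_lin => n; rewrite hq mcoeff0 addr0.
Qed.

Lemma hevN V h (p q : {lpoly V}) : (forall n, q@_n = - p@_n) ->
  hev h q = - hev h p.
Proof.
by move=> hq; rewrite -scaleN1r; apply: hevZ => n; rewrite hq scaleN1r.
Qed.

Lemma hevU V h (v : V) n : hev h << v *g n >> = h ^+ n *: v.
Proof.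
rewrite (@hevEw _ _ _ n.+1) => [|m hm].
  rewrite big_nat_recr //= mcoeffUU big_nat big1 ?add0r // => m /andP[_ hm].
  by rewrite mcoeffU gtn_eqF // mulr0n scaler0.
by rewrite mcoeffU ltn_eqF // mulr0n.
Qed.

Lemma hev_lmulX V h (p q : {lpoly V}) :
  (forall n, q@_n = lmulX p n) -> hev h q = h *: hev h p.
Proof.
move=> hq; have [K hK] := lpoly_bound p.
have hK' m : (K.+1 <= m)%N -> q@_m = 0 by rewrite hq; case: m => //= m /hK.
rewrite (hevEw _ hK') (hevEw _ hK) big_nat_recl // hq /= scaler0 add0r.
by rewrite scaler_sumr; apply: eq_bigr => n _; rewrite hq scalerA exprS.
Qed.

(** The coefficients in [lflip] are those of the binomial expansion of (- (h + d))^m, collected by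
    powers of h. *)
Lemma hev_lflip V h (p q : {lpoly V}) :
  (forall n, q@_n = lflip p n) -> hev h q = hev (- (h + 'X)) p.
Proof.
move=> hq; have [K hK] := lpoly_bound p.
have hK' n : (K <= n)%N -> q@_n = 0.
  move=> hn; rewrite hq (lflipEw _ hK) big_nat big1 // => m /andP[_ hm].
  by rewrite bin_small ?mulr0n ?scale0r // (leq_trans hm).
rewrite (hevEw _ hK') (hevEw _ hK).
under eq_bigr => n _ do rewrite hq (lflipEw _ hK) scaler_sumr.
rewrite exchange_big /=; apply: eq_big_nat => m /andP[_ mK].
rewrite [in RHS]exprNn [h + 'X]addrC exprDn mulr_sumr scaler_suml.
rewrite (big_cat_nat (n := m.+1)) //= [X in _ + X]big_nat.
rewrite [X in _ + X]big1 ?addr0 => [|n /andP[mn _]]; last first.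
  by rewrite bin_small // mulr0n scale0r scaler0.
rewrite big_mkord; apply: eq_bigr => n _; rewrite scalerA; congr (_ *: _).
by rewrite !mulrnAr; congr (_ *+ _); ring.
Qed.

(** Polynomial dependence on a scalar. The action of C on the quotient is first built as families of
    operators indexed by k; this property turns them into lambda-polynomials. *)
Definition polyfun V (f : k -> V) : Prop :=
  exists p : {lpoly V}, forall c, f c = hev c%:P p.

Lemma polyfun_hev V (p : {lpoly V}) : polyfun (fun c => hev c%:P p).
Proof. by exists p. Qed.

Lemma polyfun_ext V (f g : k -> V) : f =1 g -> polyfun f -> polyfun g.
Proof. by move=> e [p hp]; exists p => c; rewrite -e. Qed.

Lemma polyfunD V (f g : k -> V) :
  polyfun f -> polyfun g -> polyfun (fun c => f c + g c).
Proof.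
by move=> [p hp] [q hq]; exists (p + q) => c; rewrite hp hq hevD.
Qed.

Lemma polyfunZ V a (f : k -> V) : polyfun f -> polyfun (fun c => a *: f c).
Proof.
move=> [p hp]; have [K hK] := lpoly_bound p.
have [q hq] : exists q : {lpoly V}, forall n, q@_n = a *: p@_n.
  by apply: (@mk_lpoly0 V _ K) => n /hK->; rewrite scaler0.
by exists q => c; rewrite hp (hevZ _ hq).
Qed.

Lemma polyfunX V (f : k -> V) : polyfun f -> polyfun (fun c => c%:P *: f c).
Proof.
move=> [p hp]; have [q hq] := lmulX_lpoly p.
by exists q => c; rewrite hp (hev_lmulX _ hq).
Qed.

Lemma polyfunC V (v : V) : polyfun (fun=> v).
Proof. by exists << v *g 0%N >> => c; rewrite hevU expr0 scale1r. Qed.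

Lemma polyfun_sum V I (r : seq I) (F : I -> k -> V) :
  (forall i, polyfun (F i)) -> polyfun (fun c => \sum_(i <- r) F i c).
Proof.
move=> hF; elim: r => [|i r IH].
  by apply: polyfun_ext (polyfunC 0) => c; rewrite big_nil.
apply: polyfun_ext (polyfunD (hF i) IH) => c; by rewrite big_cons.
Qed.

Lemma polyfunXn V n a (f : k -> V) : polyfun f ->
  polyfun (fun c => (c%:P + a) ^+ n *: f c).
Proof.
move=> hf; elim: n => [|n IH].
  by apply: polyfun_ext hf => c; rewrite expr0 scale1r.
apply: polyfun_ext (polyfunD (polyfunX IH) (polyfunZ a IH)) => c.
by rewrite exprS -scalerA scalerDl.
Qed.

Lemma polyfun_shift V a (p : {lpoly V}) :
  polyfun (fun c => hev (c%:P + a) p).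
Proof. by apply: polyfun_sum => n; apply: polyfunXn; exact: polyfunC. Qed.

Section Infinite.
Hypothesis char0 : [pchar k] =i pred0.

Lemma natrS_neq0 n : (n.+1%:R : k) != 0.
Proof. by rewrite (proj1 (pcharf0P k) char0). Qed.

(** In characteristic zero n + 1 is invertible in k, hence in H. *)
Lemma submod_natI V (P : set V) n (v : V) : is_submod P ->
  P (v *+ n.+1) -> P v.
Proof.
move=> HP h; have -> : v = (n.+1%:R^-1 : k)%:P *: (v *+ n.+1).
  by rewrite -scaler_nat scalerA -polyC_natr -polyCM mulVf ?natrS_neq0 // scale1r.
exact: submodZ.
Qed.

Lemma mulrnI V n (u v : V) : u *+ n.+1 = v *+ n.+1 -> u = v.
Proof.
move=> e; apply/subr0_eq; apply: (@submod_natI V (fun v => v = 0) n).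
  by split=> // a x y /= -> ->; rewrite scaler0 addr0.
by rewrite mulrnBl e subrr.
Qed.

(** A substitute for the Vandermonde determinant. If S(c) is the given sum with top degree K, then
    2^K S(c) - S(2c) has no term of degree K, and its other coefficients are those of S times 2^K -
    2^n, which is nonzero in k; so induction on the degree applies. *)
Lemma submod_coef V (P : set V) (v : nat -> V) K : is_submod P ->
    (forall c : k, P (\sum_(0 <= n < K) c%:P ^+ n *: v n)) ->
  forall n, (n < K)%N -> P (v n).
Proof.
move=> HP; elim: K v => // K IH v hv.
have hlow n : (n < K)%N -> P (v n).
  move=> nK; pose w m := (2 ^ K - 2 ^ m)%N%:R%:P *: v m.
  have : P (w n).
    apply: (IH w) nK => c; pose S (c : k) := \sum_(0 <= n < K.+1) c%:P ^+ n *: v n.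
    have -> : \sum_(0 <= n < K) c%:P ^+ n *: w n =
        (2 ^ K)%:R%:P *: S c - S (2%:R * c).
      rewrite /S scaler_sumr -sumrB big_nat_recr //= [in X in _ = _ + X]scalerA.
      rewrite [in X in _ = _ + X]polyCM exprMn [in X in _ = _ + X]natrX.
      rewrite [in X in _ = _ + X]rmorphXn subrr addr0.
      apply: eq_big_nat => m /andP[_ mK].
      rewrite /w natrB ?leq_exp2l ?(ltnW mK) // polyCB !scalerA -scalerBl.
      congr (_ *: _); rewrite polyCM exprMn !natrX !rmorphXn /=; ring.
    exact: submodB HP (submodZ _ HP (hv c)) (hv _).
  have : (2 ^ n < 2 ^ K)%N by rewrite ltn_exp2l.
  rewrite -subn_gt0 /w; case: (2 ^ K - 2 ^ n)%N => // m _.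
  by rewrite polyC_natr scaler_nat; exact: submod_natI.
move=> n; rewrite ltnS leq_eqVlt => /orP[/eqP->|/hlow//].
(* The top coefficient is S(1) minus the coefficients already known to lie in [P]. *)
have := hv 1; rewrite big_nat_recr //= polyC1 expr1n scale1r addrC => h.
rewrite -[v K](addrK (\sum_(0 <= n < K) 1 ^+ n *: v n)).
apply: submodB h _ => //; rewrite big_nat; apply: submod_sum => // m /andP[_ mK].
by apply: submodZ => //; exact: hlow.
Qed.

Lemma hev_coef V (P : set V) (p : {lpoly V}) : is_submod P ->
  (forall c : k, P (hev c%:P p)) -> forall n, P p@_n.
Proof.
move=> HP hp n; have [K hK] := lpoly_bound p.
have [nK|/hK->] := ltnP n K; last exact: submod0.
by apply: (submod_coef HP) nK => c; rewrite -(hevEw _ hK).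
Qed.

Lemma submod_hev V (P : set V) h (p : {lpoly V}) : is_submod P ->
  (forall n, P p@_n) -> P (hev h p).
Proof. by move=> HP hp; apply: submod_sum => // n _; exact: submodZ. Qed.

Lemma hev_inj V (p q : {lpoly V}) :
  (forall c : k, hev c%:P p = hev c%:P q) -> p = q.
Proof.
move=> e; apply/malgP => n; apply/subr0_eq; rewrite -mcoeffB.
apply: (@hev_coef _ (fun v => v = 0)) => [|c].
  by split=> // a x y /= -> ->; rewrite scaler0 addr0.
rewrite hevD (@hevN _ _ q (- q)) ?e ?subrr // => m; exact: mcoeffN.
Qed.

Lemma submod_coef0 V (v : nat -> V) K :
    (forall c : k, \sum_(0 <= n < K) c%:P ^+ n *: v n = 0) ->
  forall n, (n < K)%N -> v n = 0.
Proof.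
move=> e n nK; apply: (@submod_coef _ (fun v => v = 0) v K) => //.
by split=> // a x y /= -> ->; rewrite scaler0 addr0.
Qed.
End Infinite.
End Evaluation.

(** * Conformal identities on values *)

Section ConformalEvaluation.
Context (k : fieldType).

(** Expanding (a + b)^q and collecting a^n b^m, a term with indices p, q contributes to n = p + q -
    m, whence the binomial sum of [conf_assoc]. Since p, q < K, the exponent n stays below K + K. *)
Lemma hev_double (V : lmodType {poly k}) (w : nat -> nat -> V) K (a b : {poly k}) :
    (forall p q, (K <= p)%N || (K <= q)%N -> w p q = 0) ->
  \sum_(0 <= p < K) a ^+ p *: (\sum_(0 <= q < K) (a + b) ^+ q *: w p q) =
  \sum_(0 <= n < K + K) a ^+ n *: (\sum_(0 <= m < K) b ^+ m *:
    (\sum_(0 <= p < n.+1) w p (n - p + m)%N *+ 'C(n - p + m, m))).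
Proof.
move=> hw.
(* The binomial formula, reindexed by q = n + m. *)
have inner p : \sum_(0 <= q < K) (a + b) ^+ q *: w p q =
    \sum_(0 <= n < K) \sum_(0 <= m < K)
      (a ^+ n * b ^+ m *+ 'C(n + m, m)) *: w p (n + m)%N.
  rewrite exchange_big /=.
  transitivity (\sum_(0 <= q < K) \sum_(0 <= m < K)
    if (m <= q)%N then (a ^+ (q - m) * b ^+ m *+ 'C(q, m)) *: w p q else 0).
    apply: eq_big_nat => q /andP[_ qK]; rewrite exprDn scaler_suml.
    rewrite -(big_mkord xpredT (fun i => (a ^+ (q - i) * b ^+ i *+ 'C(q, i)) *: w p q)).
    by rewrite (big_nat_widen _ _ K) // big_mkcond.
  rewrite exchange_big /=; apply: eq_bigr => m _.
  pose f q := (a ^+ (q - m) * b ^+ m *+ 'C(q, m)) *: w p q.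
  rewrite -[LHS](@sum_shift _ _ f) => [|q hq]; last first.
    by rewrite /f hw ?scaler0 // hq orbT.
  by apply: eq_bigr => n _; rewrite /f addnK.
(* The factor a^p is absorbed by replacing n with n + p, which moves the range of n to p <= n < p +
   K. *)
have shift p : (p < K)%N -> \sum_(0 <= n < K) a ^+ p *: (\sum_(0 <= m < K)
      (a ^+ n * b ^+ m *+ 'C(n + m, m)) *: w p (n + m)%N) =
    \sum_(0 <= n < K + K | (p <= n)%N) a ^+ n *: (\sum_(0 <= m < K)
      b ^+ m *: (w p (n - p + m)%N *+ 'C(n - p + m, m))).
  move=> pK.
  pose f n := a ^+ n *: (\sum_(0 <= m < K)
      b ^+ m *: (w p (n - p + m)%N *+ 'C(n - p + m, m))).
  have hf q : (p + K <= q)%N -> f q = 0.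
    move=> hq; rewrite /f big1 ?scaler0 // => m _.
    by rewrite hw ?mul0rn ?scaler0 //; apply/orP; right; lia.
  rewrite [RHS]big_mkcond /=.
  rewrite -(@sum_shift _ _ f) => [|q hq]; last by apply: hf; lia.
  rewrite [RHS](big_cat_nat (n := K)) ?leq_addr //=.
  rewrite [X in _ = _ + X]big_nat [X in _ = _ + X]big1 ?addr0; last first.
    by move=> n /andP[hn _]; apply: hf; lia.
  apply: eq_bigr => n _; rewrite /f addnK addnC exprD -scalerA; congr (_ *: _).
  rewrite scaler_sumr; apply: eq_bigr => m _.
  by rewrite -scalerMnr scalerMnl scalerA mulrnAr.
transitivity (\sum_(0 <= p < K) \sum_(0 <= n < K + K | (p <= n)%N) a ^+ n *:
   (\sum_(0 <= m < K) b ^+ m *: (w p (n - p + m)%N *+ 'C(n - p + m, m)))).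
  apply: eq_big_nat => p /andP[_ pK]; rewrite -shift // inner.
  by rewrite scaler_sumr.
rewrite (eq_bigr _ (fun p _ => big_mkcond _ _)) exchange_big /=.
apply: eq_big_nat => n /andP[_ nK].
rewrite -big_mkcond -scaler_sumr; congr (_ *: _).
rewrite exchange_big /=; apply: eq_bigr => m _; rewrite -scaler_sumr.
congr (_ *: _).
(* One sum has p < K and p <= n, the other p < n + 1; both are compared inside the range up to max(n
   + 1, K), as F vanishes from K on. *)
pose F p := w p (n - p + m)%N *+ 'C(n - p + m, m).
have hF p : (K <= p)%N -> F p = 0 by move=> hp; rewrite /F hw ?hp ?mul0rn.
rewrite -/(F _) big_mkcond /= [RHS](big_nat_widen _ _ (maxn n.+1 K)) ?leq_maxl //.
rewrite [RHS]big_mkcond /= [RHS](big_cat_nat (n := K)) ?leq_maxr //=.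
rewrite [X in _ = _ + X]big_nat [X in _ = _ + X]big1 ?addr0 // => p /andP[hp _].
by rewrite -/(F p) hF // if_same.
Qed.

Context (C V : lmodType {poly k}).
Context (mul : C -> C -> {lpoly C}) (act : C -> V -> {lpoly V}).

Section Conformal.
Hypothesis H : is_conformal mul act.

Lemma ev_addl h a b v : hev h (act (a + b) v) = hev h (act a v) + hev h (act b v).
Proof.
rewrite -[hev h (act a v)]scale1r; apply: hev_lin => n.
by have := conf_linl H 1 a b v n; rewrite !scale1r.
Qed.

Lemma ev_0l h v : hev h (act 0 v) = 0.
Proof. by apply: (addrI (hev h (act 0 v))); rewrite -ev_addl !addr0. Qed.

Lemma ev_Cl h (c : k) a v : hev h (act (c%:P *: a) v) = c%:P *: hev h (act a v).
Proof.
rewrite -[RHS]addr0 -(ev_0l h v); apply: hev_lin => n.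
by have := conf_linl H c a 0 v n; rewrite addr0.
Qed.

Lemma ev_Xl h a v : hev h (act ('X *: a) v) = - (h *: hev h (act a v)).
Proof.
have [p hp] := lmulX_lpoly (act a v).
rewrite -(hev_lmulX _ hp); apply: hevN => n; by rewrite hp (conf_dell H).
Qed.

End Conformal.
End ConformalEvaluation.

Section Associativity.
Context (k : fieldType) (C V : lmodType {poly k}).
Context (mul : C -> C -> {lpoly C}) (act : C -> V -> {lpoly V}).
Hypothesis linl : forall (c : k) (a b : C) (v : V) (n : nat),
  (act (c%:P *: a + b) v)@_n = c%:P *: (act a v)@_n + (act b v)@_n.
Hypothesis linr : forall (c : k) (a : C) (u v : V) (n : nat),
  (act a (c%:P *: u + v))@_n = c%:P *: (act a u)@_n + (act a v)@_n.

(** The coefficient of lambda^n mu^m in ((a_(lambda) b)_(lambda + mu) v). *)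
Let assocr a b v n m := \sum_(0 <= p < n.+1)
  (act (mul a b)@_p v)@_(n - p + m)%N *+ 'C(n - p + m, m).

(** Both sides of associativity become polynomials in the scalars c, d with a common degree bound.
    Only linearity of [act] is assumed, so the expansion serves both to pass from coefficients to
    values and to come back. *)
Lemma ev_assocE a b v : exists K, [/\ forall n m, (K <= m)%N ->
    (act a (act b v)@_m)@_n = 0 /\ assocr a b v n m = 0,
  forall n m, (K <= n)%N ->
    (act a (act b v)@_m)@_n = 0 /\ assocr a b v n m = 0,
  forall c d : k, hev c%:P (act a (hev d%:P (act b v))) =
    \sum_(0 <= n < K) c%:P ^+ n *: (\sum_(0 <= m < K) d%:P ^+ m *:
       (act a (act b v)@_m)@_n)
  & forall c d : k, hev (c + d)%:P (act (hev c%:P (mul a b)) v) =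
    \sum_(0 <= n < K) c%:P ^+ n *: (\sum_(0 <= m < K) d%:P ^+ m *:
      assocr a b v n m)].
Proof.
have act0r x n : (act x 0)@_n = 0.
  have := linr (-1) x 0 0 n.
  by rewrite scaler0 addr0 polyCN scaleN1r addNr.
have act0l x n : (act 0 x)@_n = 0.
  have := linl (-1) 0 0 x n.
  by rewrite scaler0 addr0 polyCN scaleN1r addNr.
have [K1 hK1] := lpoly_bound (act b v).
have [K2 hK2] := lpoly_bound (mul a b).
have [K3 hK3] := lpoly_bounds (fun m => act a (act b v)@_m) K1.
have [K4 hK4] := lpoly_bounds (fun m => act (mul a b)@_m v) K2.
have [K [le1 le2 le3 le4]] : exists K, [/\ K1 <= K, K2 <= K, K3 <= K & K4 <= K]%N.
    by exists (K1 + K2 + K3 + K4)%N; split; lia.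
have hw p q : (K <= p)%N || (K <= q)%N -> (act (mul a b)@_p v)@_q = 0.
  have [pK|pK] := ltnP p K2; last by rewrite hK2 ?act0l.
  by case/orP=> h; apply: (hK4 _ _ pK); lia.
have hl n m : (K <= m)%N || (K <= n)%N -> (act a (act b v)@_m)@_n = 0.
  have [pK|pK] := ltnP m K1; last by rewrite hK1 ?act0r.
  by case/orP=> h; apply: (hK3 _ _ pK); lia.
have hr n m : (K <= m)%N || (K + K <= n)%N -> assocr a b v n m = 0.
  move=> h; rewrite /assocr big_nat big1 // => p /andP[_ hp].
  by rewrite hw ?mul0rn //; case: (leqP K p) => //= ?; case/orP: h => ?; lia.
(* The bound is doubled because lambda^p (lambda + mu)^q with p, q < K has degree in lambda up to 2K
   - 2. *)
exists (K + K)%N; split.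
- by move=> n m h; rewrite hl ?hr //; lia.
- by move=> n m h; rewrite hl ?hr //; lia.
- move=> c d; set w := hev d%:P _.
  have ew n : (act a w)@_n =
      \sum_(0 <= m < K + K) d%:P ^+ m *: (act a (act b v)@_m)@_n.
    rewrite /w (@hevEw _ _ _ _ (K + K)%N) => [|m hm]; last first.
      by apply: hK1; lia.
    rewrite (big_morph (fun u => (act a u)@_n) (id1 := 0) (op1 := +%R)) //.
      apply: eq_bigr => m _; have := linr (d ^+ m) a (act b v)@_m 0 n.
      by rewrite act0r !addr0 rmorphXn.
    by move=> x y; have := linr 1 a x y n; rewrite !scale1r.
  rewrite (@hevEw _ _ _ _ (K + K)%N) => [|n hn].
    by apply: eq_bigr => n _; rewrite ew.
  by rewrite ew big1 // => m _; rewrite hl ?scaler0 //; lia.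
- move=> c d; set w := hev c%:P _.
  have ew n : (act w v)@_n =
      \sum_(0 <= p < K) c%:P ^+ p *: (act (mul a b)@_p v)@_n.
    rewrite /w (@hevEw _ _ _ _ K) => [|m hm]; last first.
      by apply: hK2; lia.
    rewrite (big_morph (fun u => (act u v)@_n) (id1 := 0) (op1 := +%R)) //.
      apply: eq_bigr => m _; have := linl (c ^+ m) (mul a b)@_m 0 v n.
      by rewrite act0l !addr0 rmorphXn.
    by move=> x y; have := linl 1 x y v n; rewrite !scale1r.
  rewrite (@hevEw _ _ _ _ K) => [|n hn]; last first.
    by rewrite ew big1 // => m _; rewrite hw ?scaler0 //; lia.
  transitivity (\sum_(0 <= p < K) c%:P ^+ p *: (\sum_(0 <= q < K)
      (c%:P + d%:P) ^+ q *: (act (mul a b)@_p v)@_q)).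
    under eq_bigr => q _ do rewrite ew scaler_sumr.
    rewrite exchange_big /=; apply: eq_bigr => p _.
    rewrite scaler_sumr; apply: eq_bigr => q _.
    by rewrite polyCD !scalerA mulrC.
  rewrite hev_double //; apply: eq_bigr => n _; congr (_ *: _).
  rewrite [RHS](big_cat_nat (n := K)) ?leq_addr //=.
  rewrite [X in _ = _ + X]big_nat [X in _ = _ + X]big1 ?addr0 // => m /andP[hm _].
  by rewrite hr ?scaler0 // hm.
Qed.

Lemma ev_assoc_of_conf :
    (forall a b v n m, (act a (act b v)@_m)@_n = assocr a b v n m) ->
  forall (c d : k) a b v, hev c%:P (act a (hev d%:P (act b v))) =
    hev (c + d)%:P (act (hev c%:P (mul a b)) v).
Proof.
move=> e c d a b v; have [K [_ _ -> ->]] := ev_assocE a b v.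
apply: eq_bigr => n _; congr (_ *: _); apply: eq_bigr => m _.
by rewrite e.
Qed.

(** A polynomial in two variables that vanishes on k x k is zero, by [submod_coef0] in one variable
    at a time. *)
Lemma conf_of_ev_assoc : [pchar k] =i pred0 ->
    (forall (c d : k) a b v, hev c%:P (act a (hev d%:P (act b v))) =
      hev (c + d)%:P (act (hev c%:P (mul a b)) v)) ->
  forall a b v n m, (act a (act b v)@_m)@_n = assocr a b v n m.
Proof.
move=> char0 e a b v n m; have [K [hm hn hl hr]] := ev_assocE a b v.
have [nK|/(hn _ m)[-> ->]//] := ltnP n K.
have [mK|/(hm n)[-> ->]//] := ltnP m K.
pose D n m := (act a (act b v)@_m)@_n - assocr a b v n m.
apply: subr0_eq; rewrite -/(D n m).
suff hd (d : k) : \sum_(0 <= m < K) d%:P ^+ m *: D n m = 0.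
  exact: (submod_coef0 char0 (v := D n) hd mK).
pose S n := \sum_(0 <= m < K) d%:P ^+ m *: D n m.
suff hc (c : k) : \sum_(0 <= n < K) c%:P ^+ n *: S n = 0.
  exact: (submod_coef0 char0 (v := S) hc nK).
have := e c d a b v; rewrite hl hr => /eqP; rewrite -subr_eq0 -sumrB => /eqP h.
rewrite -[RHS]h; apply: eq_bigr => i _; rewrite -scalerBr -sumrB; congr (_ *: _).
by apply: eq_bigr => l _; rewrite -scalerBr.
Qed.
End Associativity.

Lemma ev_assoc (k : fieldType) (C V : lmodType {poly k})
    (mul : C -> C -> {lpoly C}) (act : C -> V -> {lpoly V}) :
  is_conformal mul act -> forall (c d : k) a b v,
  hev c%:P (act a (hev d%:P (act b v))) =
    hev (c + d)%:P (act (hev c%:P (mul a b)) v).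
Proof.
by move=> H; apply: ev_assoc_of_conf (conf_linl H) (conf_linr H) (conf_assoc H).
Qed.

(** * Induction over a generated conformal algebra *)

Section Closure.
Context (k : fieldType) (char0 : [pchar k] =i pred0).

Lemma ev_subalg (C : confAlg k) (P : set C) : is_submod P ->
  (forall (a b : C) (c : k), P a -> P b -> P (hev c%:P (calg_mul a b))) ->
  is_conf_subalg P.
Proof.
by move=> HP h; split=> // a b n Pa Pb; apply: hev_coef => // c; exact: h.
Qed.

(* Since (a_(c) b)_(d) v = a_(c) (b_(d - c) v), the elements of [C] whose action
   preserves [P] form a conformal subalgebra. *)
Lemma conf_submodP (C : confAlg k) (M : confMod C) (X : choiceType) (i : X -> C)
    (P : set M) :
    smallest (@is_conf_subalg k C) (range i) = setT -> is_submod P ->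
    (forall x v n, P v -> P (cmod_act (i x) v)@_n) ->
  is_conf_submod P.
Proof.
move=> gen HP hX; split=> // a v n Pv; have HM := cmod_axioms M.
pose Q : set C := fun a => forall v c, P v -> P (hev c%:P (cmod_act a v)).
have : Q a.
  suff : smallest (@is_conf_subalg k C) (range i) `<=` Q by rewrite gen; apply.
  apply: smallest_sub; last first.
    by move=> _ [x _ <-] u c Pu; apply: submod_hev => // m; exact: hX.
  apply: ev_subalg.
    apply: submod_poly => [u c Pu|x y Qx Qy u c Pu|b x Qx u c Pu|x Qx u c Pu].
    - by rewrite (ev_0l HM); exact: submod0.
    - by rewrite (ev_addl HM); apply: submodD => //; [exact: Qx|exact: Qy].
    - by rewrite (ev_Cl HM); apply: submodZ => //; exact: Qx.
    - by rewrite (ev_Xl HM) -scaleNr; apply: submodZ => //; exact: Qx.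
  move=> x y c Qx Qy u d Pu; have := ev_assoc HM c (d - c) x y u.
  by rewrite [c + _]addrC subrK => <-; apply: Qx; exact: Qy.
by move=> Qa; apply: hev_coef => // c; exact: Qa.
Qed.

Definition regmod (C : confAlg k) : confMod C := ConfMod (calg_axioms C).

(** Left multiplication by generators is enough: by [conf_submodP] for the regular module, a
    submodule stable under it is a left ideal, and a left ideal containing the generators is a
    subalgebra containing them. *)
Lemma conf_algP (C : confAlg k) (X : choiceType) (i : X -> C) (P : set C) :
    smallest (@is_conf_subalg k C) (range i) = setT -> is_submod P ->
    (forall x, P (i x)) -> (forall x v n, P v -> P (calg_mul (i x) v)@_n) ->
  forall a, P a.
Proof.
move=> gen HP hi hX; suff : setT `<=` P by move=> h a; exact: h.
rewrite -gen; apply: smallest_sub; last by move=> _ [x _ <-].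
have [_ h] := @conf_submodP C (regmod C) X i P gen HP hX.
by split=> // a b n _ Pb; exact: h.
Qed.
End Closure.

(** * Modules over A(Z) *)

Section Semilinear.
Context (A B : nzRingType) (s : {rmorphism A -> B}).

(** Linearity along a change of rings, needed for maps from A(X)-modules to A(X + Y)-modules; for
    [s = idfun] it is ordinary linearity. *)
Definition semilin (V : lmodType A) (W : lmodType B) (h : V -> W) : Prop :=
  forall a u v, h (a *: u + v) = s a *: h u + h v.

Section Maps.
Context (V : lmodType A) (W : lmodType B) (h : V -> W).
Hypothesis hl : semilin h.

Lemma semilinD u v : h (u + v) = h u + h v.
Proof. by have := hl 1 u v; rewrite rmorph1 !scale1r. Qed.

Lemma semilin0 : h 0 = 0.
Proof.
by have := hl (-1) 0 0; rewrite scaler0 addr0 rmorphN1 scaleN1r addNr.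
Qed.

Lemma semilinZ a u : h (a *: u) = s a *: h u.
Proof. by have := hl a u 0; rewrite semilin0 !addr0. Qed.

Lemma semilinB u v : h (u - v) = h u - h v.
Proof. by rewrite addrC -scaleN1r hl rmorphN1 scaleN1r addrC. Qed.

Lemma semilin_sum I (r : seq I) (F : I -> V) :
  h (\sum_(i <- r) F i) = \sum_(i <- r) h (F i).
Proof. exact: (big_morph h semilinD semilin0). Qed.

Context (G : set V).
Hypothesis hG : forall v, G v -> h v = 0.

Lemma semilin_gen v : submod_gen G v -> h v = 0.
Proof.
apply: (smallest_sub (X := [set v | h v = 0])) => //; split=> [|a u w /= hu hw].
  exact: semilin0.
by rewrite hl hu hw scaler0 addr0.
Qed.

Definition quotlift (x : quotmod G) : W := h (repr x).

Lemma quotlift_proj v : quotlift (qproj G v) = h v.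
Proof.
apply: subr0_eq; rewrite -semilinB; apply: semilin_gen.
by apply/qproj_eq; rewrite qproj_repr.
Qed.

Lemma quotlift_semilin a x y :
  quotlift (a *: x + y) = s a *: quotlift x + quotlift y.
Proof.
by rewrite -(qproj_repr x) -(qproj_repr y) -linearP !quotlift_proj hl.
Qed.
End Maps.

Section Eval.
Context (Y : choiceType) (W : lmodType B) (j : Y -> W).

(** This has both [freemod_eval] (for [s = idfun]) and [freemod_map] (for [s = Amap f] and [j] a
    family of basis vectors) as instances, by conversion. *)
Definition sfeval (u : {malg A[Y]}) : W := \sum_(y <- msupp u) s u@_y *: j y.

Lemma sfevalEw (d : {fset Y}) u : (msupp u `<=` d)%fset ->
  sfeval u = \sum_(y <- d) s u@_y *: j y.
Proof.
move=> le; rewrite /sfeval [LHS](big_fset_incl _ le) => //= y _ hy.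
by rewrite mcoeff_outdom // rmorph0 scale0r.
Qed.

Lemma sfeval_semilin : semilin sfeval.
Proof.
move=> a u v; pose d := (msupp u `|` msupp v `|` msupp (a *: u + v))%fset.
have hu : (msupp u `<=` d)%fset by rewrite /d -fsetUA fsubsetUl.
have hv : (msupp v `<=` d)%fset by rewrite /d fsetUAC fsubsetUr.
rewrite (sfevalEw hu) (sfevalEw hv) (@sfevalEw d) ?fsubsetUr //.
rewrite scaler_sumr -big_split; apply: eq_bigr => y _ /=.
by rewrite mcoeffD mcoeffZ rmorphD rmorphM scalerDl scalerA.
Qed.

Lemma sfevalU a y : sfeval << a *g y >> = s a *: j y.
Proof. by rewrite (sfevalEw msuppU_le) big_seq_fset1 mcoeffUU. Qed.
End Eval.
End Semilinear.

Lemma malg_ind (A : nzRingType) (Y : choiceType) (P : {malg A[Y]} -> Prop) :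
  P 0 -> (forall u v, P u -> P v -> P (u + v)) ->
  (forall a y, P << a *g y >>) -> forall u, P u.
Proof.
move=> h0 hD hU u; rewrite (monalgE u); exact: (big_ind P).
Qed.

Definition restriction (A B : nzRingType) (s : {rmorphism A -> B})
  (V : lmodType B) : Type := V.

Section Restriction.
Context (A B : nzRingType) (s : {rmorphism A -> B}) (V : lmodType B).
Local Notation restrict := (restriction s V).

HB.instance Definition _ := GRing.Zmodule.on restrict.

Definition restrict_scale (a : A) (v : restrict) : restrict := s a *: (v : V).

Lemma restrict_scaleA a b v :
  restrict_scale a (restrict_scale b v) = restrict_scale (a * b) v.
Proof. by rewrite /restrict_scale rmorphM scalerA. Qed.
Lemma restrict_scale1 : left_id 1 restrict_scale.
Proof. by move=> v; rewrite /restrict_scale rmorph1 scale1r. Qed.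
Lemma restrict_scaleDr : right_distributive restrict_scale +%R.
Proof. by move=> a u v; exact: scalerDr. Qed.
Lemma restrict_scaleDl v : {morph restrict_scale^~ v : a b / a + b}.
Proof. by move=> a b; rewrite /restrict_scale rmorphD; exact: scalerDl. Qed.
HB.instance Definition _ := GRing.Zmodule_isLmodule.Build A restrict
  restrict_scaleA restrict_scale1 restrict_scaleDr restrict_scaleDl.
End Restriction.

Lemma scale_in_algC (k : comNzRingType) (A : algType k) (E : lmodType A) (c : k)
    (a : A) (e : E) : a *: (c%:A *: e) = c%:A *: (a *: e).
Proof. by rewrite !scalerA mulr_algl mulr_algr. Qed.

(** * A(Z)-modules as H-modules with operators *)

Section AlgA.
Context (k : fieldType) (Z : choiceType).
Local Notation AZ := (algA k Z).

(** A(Z) is spanned over k by words, and a word grows from a scalar by left multiplication by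
    generators. *)
Lemma algA_ind (P : AZ -> Prop) :
  (forall c : k, P c%:A) -> (forall a b, P a -> P b -> P (a + b)) ->
  (forall g a, P a -> P (Agen k g * a)) -> forall a, P a.
Proof.
move=> hc hD hg a; rewrite -(Aproj_repr a).
move: (repr a); apply: malg_ind => [|u v hu hv|c w].
- by rewrite raddf0; have := hc 0; rewrite scale0r.
- by rewrite raddfD; exact: hD.
have word (w1 w2 : {fmonom gen Z}) : << c *g (mmul w1 w2) >> =
    << 1 *g w1 >> * << c *g w2 >> :> {malg k[{fmonom gen Z}]}.
  by rewrite malgM_def fgmulUU mul1r.
case: w => w; elim: w => [|g w IH].
  have -> : @FMonom _ [::] = mone :> {fmonom gen Z} by exact: esym (fmoneE _).
  have -> : Aproj << c *g mone >> = c%:A :> AZ by exact: esym (mulr1 _).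
  exact: hc.
have -> : @FMonom _ (g :: w) = mmul (fmu g) (FMonom w) :> {fmonom gen Z}.
  by apply: val_inj; rewrite /= fmM fmU.
rewrite word rmorphM; exact: hg.
Qed.

Lemma Agen_del (n : nat) (a : Z) :
  (Agen k (GL n a) * Agen k GD =
     Agen k GD * Agen k (GL n a) + Agen k (GL n.-1 a) *+ n) /\
  (Agen k (GR n a) * Agen k GD =
     Agen k GD * Agen k (GR n a) + Agen k (GR n.-1 a) *+ n).
Proof.
have h (p q r : {malg k[{fmonom gen Z}]}) :
    Arel (p - q - r) -> Aproj p = Aproj q + Aproj r.
  move=> hr; rewrite -raddfD; apply/Aproj_eq; rewrite opprD addrA.
  exact: sub_gen_smallest.
by split; rewrite /Agen -raddfMn -!rmorphM; apply: h; left; [left|right];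
  exists n, a.
Qed.

Lemma Agen_RL (n m : nat) (a b : Z) :
  Agen k (GR n a) * Agen k (GL m b) = Agen k (GL m b) * Agen k (GR n a).
Proof.
rewrite /Agen -!rmorphM; apply/Aproj_eq; apply: sub_gen_smallest; right.
by exists n, m, a, b.
Qed.

Definition hornerA : {rmorphism {poly k} -> AZ} := horner_alg (Agen k GD).

(** Restriction of scalars along k[d] -> A(Z), so that lambda-polynomials and their values make
    sense over an A(Z)-module. *)
Definition Hmod (E : lmodType AZ) : lmodType {poly k} := restriction hornerA E.

Section HmodTheory.
Context (E : lmodType AZ).
Implicit Types (e : Hmod E) (z : Z).

Definition gact (g : gen Z) (e : Hmod E) : Hmod E := Agen k g *: (e : E).

Lemma HmodX e : 'X *: e = gact GD e.
Proof. by rewrite {1}/GRing.scale /= /restrict_scale /= horner_algX. Qed.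

Lemma HmodC (c : k) e : c%:P *: e = c%:A *: (e : E) :> E.
Proof. by rewrite {1}/GRing.scale /= /restrict_scale /= horner_algC. Qed.

Lemma gactD g e e' : gact g (e + e') = gact g e + gact g e'.
Proof. exact: (@scalerDr _ E). Qed.

Lemma gactC g (c : k) e : gact g (c%:P *: e) = c%:P *: gact g e.
Proof.
have h := scale_in_algC c (Agen k g) (e : E).
have h1 : gact g (c%:P *: e) = Agen k g *: (c%:A *: (e : E)) :> E.
  by rewrite -HmodC.
by apply: etrans h1 (etrans h _); rewrite -HmodC.
Qed.

Lemma gactL_del n z e :
  gact (GL n z) ('X *: e) = 'X *: gact (GL n z) e + gact (GL n.-1 z) e *+ n.
Proof.
have h : Agen k (GL n z) *: (Agen k GD *: (e : E)) = Agen k GD *: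
    (Agen k (GL n z) *: (e : E)) + Agen k (GL n.-1 z) *: (e : E) *+ n.
  by rewrite !scalerA (Agen_del n z).1 scalerDl scalerMnl.
by rewrite !HmodX; exact: h.
Qed.

Lemma gactR_del n z e :
  gact (GR n z) ('X *: e) = 'X *: gact (GR n z) e + gact (GR n.-1 z) e *+ n.
Proof.
have h : Agen k (GR n z) *: (Agen k GD *: (e : E)) = Agen k GD *:
    (Agen k (GR n z) *: (e : E)) + Agen k (GR n.-1 z) *: (e : E) *+ n.
  by rewrite !scalerA (Agen_del n z).2 scalerDl scalerMnl.
by rewrite !HmodX; exact: h.
Qed.

Lemma gactRL n m a b e :
  gact (GR n a) (gact (GL m b) e) = gact (GL m b) (gact (GR n a) e).
Proof.
have h : Agen k (GR n a) *: (Agen k (GL m b) *: (e : E)) =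
    Agen k (GL m b) *: (Agen k (GR n a) *: (e : E)).
  by rewrite !scalerA Agen_RL.
exact: h.
Qed.

(** Stability under d is part of being an H-submodule, so only the generators L and R remain to be
    checked. *)
Lemma gact_ind (P : set (Hmod E)) : is_submod P ->
  (forall n z e, P e -> P (gact (GL n z) e)) ->
  (forall n z e, P e -> P (gact (GR n z) e)) ->
  forall (a : AZ) (e : E), P e -> P (a *: e).
Proof.
move=> HP hL hR; apply: algA_ind => [c|a b ha hb|g a ha] e Pe.
- by rewrite -(HmodC c (e : Hmod E)); exact: submodZ.
- by rewrite scalerDl; apply: (submodD HP); [exact: ha|exact: hb].
rewrite -scalerA; case: g => [|n z|n z].
- by have := submodZ 'X HP (ha e Pe); rewrite HmodX.
- exact/hL/ha.
- exact/hR/ha.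
Qed.
End HmodTheory.

(** Since d acts on [opmodule o] as 'X, restriction to k[d] gives back the H-module [V]. *)
Lemma opmod_poly (V : lmodType {poly k}) (o : ops Z V) (p : {poly k}) (v : V) :
  hornerA p *: (v : opmodule o) = (p *: v : V).
Proof.
elim/poly_ind: p v => [|p c IH] v; first by rewrite rmorph0 !scale0r.
rewrite rmorphD rmorphM /= horner_algX horner_algC !scalerDl; congr (_ + _).
  by rewrite -scalerA [X in _ *: X](act_gen o GD) /= IH scalerA.
have -> : c%:A = Aproj c%:MP :> AZ by exact: mulr1.
apply: etrans (act_proj _ _ _) _.
by rewrite op_freeU /op_word fm1.
Qed.

Lemma opmod_gen (V : lmodType {poly k}) (o : ops Z V) g (v : opmodule o) :
  Agen k g *: v = op_gen o g v.
Proof. exact: act_gen. Qed.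
End AlgA.

Lemma horner_alg_scale (k : comNzRingType) (A : algType k) (d a : A) (c : k) s :
  c *: (d ^+ s * a) = horner_alg d (c%:P * 'X^s) * a.
Proof.
by rewrite rmorphM rmorphXn /= horner_algX horner_algC mulr_algl scalerAl.
Qed.

(** The argument of [h] has the shape of the second family in [Mrel]; its image is rewritten with
    the scalars c_s d^s of A read as polynomials of H. *)
Lemma semilin_flip (k : fieldType) (A : algType k) (F V : lmodType A)
    (h : F -> V) (d r : A) (l : nat -> A) (c : nat -> k) (u v : F) n :
    semilin idfun h ->
  h (r *: u - \sum_(s < n) (c s *: (d ^+ s * l s)) *: v) =
  (r *: h u : restriction (horner_alg d) V) - \sum_(s < n) ((c s)%:P * 'X^s) *:
    (l s *: h v : restriction (horner_alg d) V).
Proof.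
move=> hl; rewrite (semilinB hl) (semilin_sum hl) (semilinZ hl).
congr (_ - _); apply: eq_bigr => s _; rewrite (semilinZ hl) horner_alg_scale.
exact: esym (scalerA (horner_alg d ((c s)%:P * 'X^s)) (l s) (h v)).
Qed.

Lemma malgUZ (A : nzRingType) (Y : choiceType) (a : A) (y : Y) :
  << a *g y >> = a *: << 1 *g y >> :> {malg A[Y]}.
Proof. by apply/malgP => w; rewrite mcoeffZ !mcoeffU mulrnAr mulr1. Qed.

(** With L_n = n! q_n, the right-hand side is the formula for R_m in the relations of M(Z,N): those
    relations express that right multiplication is the flip of left multiplication. *)
Lemma lflip_sum (k : fieldType) (V : lmodType {poly k}) (q : {lpoly V}) N m :
    [pchar k] =i pred0 -> (forall n, (N <= n)%N -> q@_n = 0) ->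
  lflip q m *+ m`! = \sum_(s < N.+1 - m)
    (((-1) ^+ (m + s) / (s`!)%:R : k)%:P * 'X^s) *: (q@_(m + s)%N *+ (m + s)`!).
Proof.
move=> char0 hN.
(* The sum in the relations runs up to m + s = N, one step beyond the degree bound, so the bound is
   relaxed to match; the extra coefficient is zero. *)
have hN' n : (N.+1 <= n)%N -> q@_n = 0 by move=> h; apply: hN; exact: ltnW.
rewrite (lflipEw _ hN') -(big_mkord xpredT (fun s =>
  (((-1) ^+ (m + s) / (s`!)%:R : k)%:P * 'X^s) *: (q@_(m + s)%N *+ (m + s)`!))).
have [mN|Nm] := leqP m N.+1; last first.
  rewrite (eqP (ltnW Nm : (N.+1 - m == 0)%N)) big_geq // big_nat big1 ?mul0rn //.
  by move=> n /andP[_ h]; rewrite bin_small ?mulr0n ?scale0r //; lia.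
rewrite (big_cat_nat (n := m)) //= big_nat big1 ?add0r => [|n /andP[_ h]]; last first.
  by rewrite bin_small // mulr0n scale0r.
rewrite -{1}[m]add0n big_addn -sumrMnl; apply: eq_bigr => s _.
rewrite [(s + m)%N]addnC addKn -scalerMnr !scalerMnl -mulrnA; congr (_ *: _).
(* C(m + s, m) m! s! = (m + s)! accounts for the division by s!. *)
have := @bin_fact (m + s) m (leq_addr _ _); rewrite addKn => <-.
rewrite [(m`! * _)%N]mulnC mulnCA [RHS]mulrnA; congr (_ *+ _).
rewrite -mulrnAl -polyCMn -[X in X%:P]mulr_natr mulfVK; last first.
  by have := natrS_neq0 char0 s`!.-1; rewrite prednK ?fact_gt0.
by rewrite rmorphXn rmorphN1.
Qed.

(** * The quotients of M(Z, N) *)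

Section Presentation.
Context (k : fieldType) (Z : choiceType) (N : Z -> Z -> nat).
Context (S : set (freemod k Z Z)).
Local Notation E := (presM N S).
Local Notation EH := (Hmod E).

Definition presproj (u : freemod k Z Z) : E := qproj (Mproj N @` S) (Mproj N u).

Lemma presproj_semilin : semilin idfun presproj.
Proof.
by move=> a u v; rewrite /presproj /Mproj !linearP.
Qed.

Lemma presproj_surj (e : E) : exists u, presproj u = e.
Proof.
by exists (repr (repr e)); rewrite /presproj /Mproj !qproj_repr.
Qed.

Lemma presproj_rel u : S u -> presproj u = 0.
Proof.
move=> Su; rewrite /presproj -(raddf0 (qproj (Mproj N @` S))); apply/qproj_eq.
by rewrite subr0; apply: sub_gen_smallest; exists u.
Qed.

Lemma presproj_Mrel u : Mrel N u -> presproj u = 0.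
Proof.
move=> Mu; rewrite /presproj.
suff -> : Mproj N u = 0 by exact: raddf0.
rewrite /Mproj -(raddf0 (qproj (Mrel N))); apply/qproj_eq.
by rewrite subr0; exact: sub_gen_smallest.
Qed.

Definition pgen (z : Z) : EH := presM_gen N S z.

Lemma pgen_L a b n : (N a b <= n)%N -> gact (GL n a) (pgen b) = 0.
Proof.
move=> h; have := @presproj_Mrel (Agen k (GL n a) *: fbasis k Z b).
rewrite (semilinZ presproj_semilin); apply.
by left; exists a, b, n.
Qed.

Lemma pgen_R a b m : gact (GR m b) (pgen a) =
  \sum_(s < (N a b).+1 - m) (((-1) ^+ (m + s) / (s`!)%:R : k)%:P * 'X^s) *:
     gact (GL (m + s) a) (pgen b).
Proof.
apply: subr0_eq; pose c s : k := (-1) ^+ (m + s) / s`!%:R.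
have h := semilin_flip (Agen k GD) (Agen k (GR m b))
  (fun s => Agen k (GL (m + s) a)) c (fbasis k Z a) (fbasis k Z b)
  ((N a b).+1 - m) presproj_semilin.
apply: etrans (esym h) _.
by apply: presproj_Mrel; right; exists a, b, m.
Qed.

Lemma pres_ind (P : set EH) : is_submod P ->
  (forall n z e, P e -> P (gact (GL n z) e)) ->
  (forall n z e, P e -> P (gact (GR n z) e)) ->
  (forall z, P (pgen z)) -> forall e, P e.
Proof.
move=> HP hL hR hg e; have [u <-] := presproj_surj e.
move: u; apply: malg_ind => [|u v hu hv|a z].
- by rewrite (semilin0 presproj_semilin); exact: (submod0 HP).
- by rewrite (semilinD presproj_semilin); exact: (submodD HP).
have e1 : << a *g z >> = a *: fbasis k Z z :> freemod k Z Z := malgUZ a z.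
have h := gact_ind HP hL hR a (hg z).
rewrite e1 (semilinZ presproj_semilin).
exact: h.
Qed.

Section Lift.
Context (B : nzRingType) (s : {rmorphism algA k Z -> B}) (W : lmodType B).
Context (j : Z -> W).
Hypothesis hS : forall u, S u -> sfeval s j u = 0.
Hypothesis hM : forall u, Mrel N u -> sfeval s j u = 0.

(** The universal property of the presented module, along a change of rings: [sfeval s j] descends
    first modulo [Mrel], then modulo [S]. *)
Lemma pres_lift : exists h : E -> W, semilin s h /\
  forall u, h (presproj u) = sfeval s j u.
Proof.
pose h1 := quotlift (sfeval s j) (G := Mrel N).
have h1l : semilin s h1 := quotlift_semilin (sfeval_semilin s j) hM.
have h1p u : h1 (Mproj N u) = sfeval s j u := quotlift_proj (sfeval_semilin s j) hM u.
have hG v : (Mproj N @` S) v -> h1 v = 0 by move=> [u Su <-]; rewrite h1p hS.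
exists (quotlift h1 (G := Mproj N @` S)); split.
  exact (quotlift_semilin h1l hG).
by move=> u; rewrite /presproj (quotlift_proj h1l hG).
Qed.
End Lift.
End Presentation.

(** * Functoriality in the set of generators *)

Lemma rmorph_horner_alg (k : comNzRingType) (A B : algType k)
    (s : {rmorphism A -> B}) : (forall (c : k) a, s (c *: a) = c *: s a) ->
  forall d p, s (horner_alg d p) = horner_alg (s d) p.
Proof.
move=> hs d p; elim/poly_ind: p => [|p c IH]; first by rewrite !rmorph0.
by rewrite !rmorphD !rmorphM IH /= !horner_algX !horner_algC hs rmorph1.
Qed.

Section AmapTheory.
Context (k : fieldType) (X Z : choiceType) (f : X -> Z).

Lemma Amap_scale (c : k) (a : algA k X) : Amap f (c *: a) = c *: Amap f a.
Proof.
have -> : c *: a = Aproj c%:MP * a by [].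
rewrite (Amap_monoid_morphism k f).2 Amap_proj.
suff -> : free_map f c%:MP = c%:MP :> {malg k[{fmonom gen Z}]} by [].
by rewrite /free_map mmapU mmorph1 mulr1.
Qed.

Lemma Amap_horner (p : {poly k}) : Amap f (hornerA k X p) = hornerA k Z p.
Proof.
have := rmorph_horner_alg (s := Amap f) Amap_scale (Agen k GD) p.
by rewrite /= Amap_gen.
Qed.
End AmapTheory.

Lemma idfun_sfeval (A : nzRingType) (V W : lmodType A) (h : V -> W)
    (A' : nzRingType) (s : {rmorphism A' -> A}) (Y : choiceType) (j : Y -> V)
    (u : {malg A'[Y]}) :
  semilin idfun h -> h (sfeval s j u) = sfeval s (h \o j) u.
Proof.
move=> hl; rewrite /sfeval (semilin_sum hl); apply: eq_bigr => y _.
by rewrite (semilinZ hl).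
Qed.

Lemma Mrel_map (k : fieldType) (X Z : choiceType) (f : X -> Z)
    (N : X -> X -> nat) (N' : Z -> Z -> nat) (u : freemod k X X) :
  (forall a b, N' (f a) (f b) = N a b) -> Mrel N u ->
  Mrel N' (freemod_map f f u).
Proof.
move=> hN; have hl : semilin (Amap (k := k) f) (freemod_map (k := k) f f).
  exact: sfeval_semilin.
have hb b : freemod_map f f (fbasis k X b) = fbasis k Z (f b).
  by have := sfevalU (Amap f) (fun y => fbasis k Z (f y)) 1 b; rewrite rmorph1 scale1r.
have hZ (a : algA k X) v : freemod_map f f (a *: v) = Amap f a *: freemod_map f f v.
  exact: semilinZ hl a v.
have aM (a b : algA k X) : Amap f (a * b) = Amap f a * Amap f b by exact: rmorphM.
have aX (a : algA k X) n : Amap f (a ^+ n) = Amap f a ^+ n by exact: rmorphXn.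
move=> [[a [b [n [h ->]]]]|[a [b [m ->]]]].
  left; exists (f a), (f b), n; split; first by rewrite hN.
  by rewrite hZ hb Amap_gen.
right; exists (f a), (f b), m; rewrite hN (semilinB hl) hZ hb Amap_gen.
congr (_ - _); rewrite (semilin_sum hl); apply: eq_bigr => s _.
by rewrite hZ hb Amap_scale aM aX !Amap_gen.
Qed.

Lemma semilin_sfeval (A B : nzRingType) (s : {rmorphism A -> B})
    (V : lmodType A) (W : lmodType B) (h : V -> W) (Y : choiceType) (j : Y -> V)
    (u : {malg A[Y]}) :
  semilin s h -> h (sfeval idfun j u) = sfeval s (h \o j) u.
Proof.
move=> hl; rewrite /sfeval (semilin_sum hl); apply: eq_bigr => y _.
by rewrite (semilinZ hl).
Qed.

(** * The map from C to the quotient of M(X + Y, N) *)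

Section AlgebraPart.
Context (k : fieldType) (X Y : choiceType) (C : confAlg k) (i : X -> C).
Context (N : X -> X -> nat) (N' : X -> Y -> nat).
Context (S : set (freemod k X X)) (T : set (freemod k X Y)).
Local Notation E := (presM (snull_loc N N') (snull_rel S T)).
Local Notation EH := (Hmod E).
Local Notation e_ := (pgen (snull_loc N N') (snull_rel S T)).

(** The presentation identifies C with the quotient of M(X,N) by S. The relations of M(X,N) and S
    hold among the images of X in the larger quotient, so [pres_lift] along A(X) -> A(X + Y)
    applies; [g] is the lift composed with the inverse of the presenting isomorphism. *)
Lemma alg_section : conf_alg_presented i N S -> exists g : C -> EH,
  [/\ forall p u v, g (p *: u + v) = p *: g u + g v,
      forall x n u, g (Lop (@calg_mul k C) (i x) n u) = gact (GL n (inl x)) (g u),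
      forall x n u, g (Rop (i x) n u) = gact (GR n (inl x)) (g u)
    & forall x, g (i x) = e_ (inl x)].
Proof.
move=> [_ _ [f [[f' fK f'K] fi]]].
pose s : {rmorphism algA k X -> algA k (X + Y)%type} := Amap inl.
pose j x : E := e_ (inl x).
have psl := presproj_semilin (snull_loc N N') (snull_rel S T).
have hj u : sfeval s j u =
    presproj (snull_loc N N') (snull_rel S T) (freemod_map inl inl u).
  exact: esym (idfun_sfeval s (fun x => fbasis k _ (inl x)) u psl).
have hS u : S u -> sfeval s j u = 0.
  by move=> Su; rewrite hj; apply: presproj_rel; left; left; exists u.
have hM u : Mrel N u -> sfeval s j u = 0.
  by move=> Mu; rewrite hj; apply: presproj_Mrel; apply: Mrel_map Mu.
have [h [hl hp]] := pres_lift hS hM.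
pose g (c : opmodule (alg_ops i)) : E := h (f' c).
have gl : semilin s g.
  move=> a u v; rewrite /g -hl; congr h; apply: (can_inj fK).
  by rewrite linearP !f'K.
have sgen x : s (Agen k x) = Agen k (gen_map inl x) := Amap_gen k inl x.
exists g; split.
- move=> p u v.
  have := gl (hornerA k X p) u v; rewrite opmod_poly.
  have e : s (hornerA k X p) = hornerA k _ p := Amap_horner _ p.
  by rewrite e.
- move=> x n u; rewrite -[Lop _ _ _ u](@opmod_gen _ _ _ (alg_ops i) (GL n x) u).
  by rewrite (semilinZ gl (Agen k (GL n x)) u) sgen.
- move=> x n u; rewrite -[Rop _ _ u](@opmod_gen _ _ _ (alg_ops i) (GR n x) u).
  by rewrite (semilinZ gl (Agen k (GR n x)) u) sgen.
- move=> x; rewrite /g -(fi x) fK.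
  have := hp (fbasis k X x); rewrite sfevalU rmorph1 scale1r; exact.
Qed.
End AlgebraPart.

Lemma conf_algP_Lop (k : fieldType) (char0 : [pchar k] =i pred0) (C : confAlg k)
    (X : choiceType) (i : X -> C) (P : set C) :
    smallest (@is_conf_subalg k C) (range i) = setT -> is_submod P ->
    (forall x, P (i x)) ->
    (forall x v n, P v -> P (Lop (@calg_mul k C) (i x) n v)) ->
  forall a, P a.
Proof.
move=> gen HP hi hL; apply: (conf_algP char0 gen HP hi) => x v n Pv.
apply: (submod_natI char0 (n := n`!.-1) HP); rewrite prednK ?fact_gt0 //.
exact: hL.
Qed.

(** * Submodules cut out by the operators L and R *)

Section OpsTheory.
Context (k : fieldType) (Z : choiceType) (V : lmodType {poly k}) (o : ops Z V).

Lemma opLD n z u v : opL o n z (u + v) = opL o n z u + opL o n z v.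
Proof. by have := opL_lin o n z 1 u v; rewrite !scale1r. Qed.

Lemma opL0 n z : opL o n z 0 = 0.
Proof.
by have := opL_lin o n z (-1) 0 0; rewrite scaler0 addr0 polyCN scaleN1r addNr.
Qed.

Lemma opLC n z (c : k) u : opL o n z (c%:P *: u) = c%:P *: opL o n z u.
Proof. by have := opL_lin o n z c u 0; rewrite opL0 !addr0. Qed.

Lemma opRD n z u v : opR o n z (u + v) = opR o n z u + opR o n z v.
Proof. by have := opR_lin o n z 1 u v; rewrite !scale1r. Qed.

Lemma opR0 n z : opR o n z 0 = 0.
Proof.
by have := opR_lin o n z (-1) 0 0; rewrite scaler0 addr0 polyCN scaleN1r addNr.
Qed.

Lemma opRC n z (c : k) u : opR o n z (c%:P *: u) = c%:P *: opR o n z u.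
Proof. by have := opR_lin o n z c u 0; rewrite opR0 !addr0. Qed.

Lemma opRMn n z u m : opR o n z (u *+ m) = opR o n z u *+ m.
Proof. by elim: m => [|m IH]; rewrite ?mulr0n ?opR0 // !mulrS opRD IH. Qed.

(** The condition ranges over all n at once because L_n does not commute with d: L_n d = d L_n + n
    L_(n-1). *)
Lemma opL_submod (P : set V) : is_submod P ->
  is_submod (fun u => forall n z, P (opL o n z u)).
Proof.
move=> HP; apply: submod_poly.
- by move=> n z; rewrite opL0; exact: submod0.
- by move=> u v hu hv n z; rewrite opLD; exact: submodD.
- by move=> c v hv n z; rewrite opLC; exact: submodZ.
- move=> v hv n z; rewrite opL_del; apply: submodD => //; first exact: submodZ.
  exact: submodMn.
Qed.

Lemma opR_submod (P : set V) : is_submod P ->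
  is_submod (fun u => forall n z, P (opR o n z u)).
Proof.
move=> HP; apply: submod_poly.
- by move=> n z; rewrite opR0; exact: submod0.
- by move=> u v hu hv n z; rewrite opRD; exact: submodD.
- by move=> c v hv n z; rewrite opRC; exact: submodZ.
- move=> v hv n z; rewrite opR_del; apply: submodD => //; first exact: submodZ.
  exact: submodMn.
Qed.

(** The common kernel of the R_n^z, stable under d and L; on it the operators behave as on a left
    conformal module, where R acts as zero. *)
Definition kerR : set V := fun u => forall n z, opR o n z u = 0.

Lemma submod_eq0 : is_submod (fun v : V => v = 0).
Proof. by split=> // a u v /= -> ->; rewrite scaler0 addr0. Qed.

Lemma kerR_submod : is_submod kerR.
Proof. exact: opR_submod submod_eq0. Qed.

Lemma kerR_L u n z : kerR u -> kerR (opL o n z u).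
Proof. by move=> hu m w; rewrite opRL hu opL0. Qed.
End OpsTheory.

(** Division by n! packs operators L_n that vanish for large n on a vector into the
    lambda-polynomial sum_n lambda^n / n! L_n. *)
Lemma fact_lpoly (k : fieldType) (char0 : [pchar k] =i pred0)
    (V : lmodType {poly k}) (v : nat -> V) K :
  (forall n, (K <= n)%N -> v n = 0) ->
  exists p : {lpoly V}, forall n, v n = p@_n *+ n`!.
Proof.
move=> hK; have [p hp] : exists p : {lpoly V}, forall n,
    p@_n = ((n`!)%:R^-1 : k)%:P *: v n.
  by apply: (@mk_lpoly0 _ _ _ K) => n /hK->; rewrite scaler0.
exists p => n; rewrite hp -scaler_nat scalerA -polyC_natr -polyCM.
rewrite mulfV ?scale1r //.
by have := natrS_neq0 char0 n`!.-1; rewrite prednK ?fact_gt0.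
Qed.

Lemma factnI (k : fieldType) (char0 : [pchar k] =i pred0) (V : lmodType {poly k}) n
    (u v : V) : u *+ n`! = v *+ n`! -> u = v.
Proof. by rewrite -(prednK (fact_gt0 n)); exact: mulrnI. Qed.


Lemma opmod_C (k : fieldType) (Z : choiceType) (V : lmodType {poly k}) (o : ops Z V)
    (c : k) (v : V) :
  (c%:A : algA k Z) *: (v : opmodule o) = (c%:P *: v : V).
Proof. by rewrite -opmod_poly /= horner_algC. Qed.

Lemma semilin_gens (k : fieldType) (X Z : choiceType) (f : X -> Z)
    (V : lmodType (algA k X)) (W : lmodType (algA k Z)) (h : V -> W) :
  (forall u v, h (u + v) = h u + h v) ->
  (forall (c : k) v, h (c%:A *: v) = c%:A *: h v) ->
  (forall g v, h (Agen k g *: v) = Agen k (gen_map f g) *: h v) ->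
  semilin (Amap f) h.
Proof.
move=> hD hC hg.
have aD (a b : algA k X) : Amap f (a + b) = Amap f a + Amap f b by exact: rmorphD.
have aM (a b : algA k X) : Amap f (a * b) = Amap f a * Amap f b by exact: rmorphM.
have a1 : Amap f (1 : algA k X) = 1 by exact: rmorph1.
suff hZ (a : algA k X) v : h (a *: v) = Amap f a *: h v.
  by move=> a u v; rewrite hD hZ.
move: a v; apply: algA_ind => [c v|a b ha hb v|g a ha v].
- by rewrite hC Amap_scale a1.
- by rewrite scalerDl hD ha hb aD scalerDl.
- by rewrite -scalerA hg ha aM Amap_gen scalerA.
Qed.

(** The first family of relations is locality of the generators, the second is [lflip_sum] applied
    to their products. *)
Lemma alg_ops_Mrel (k : fieldType) (char0 : [pchar k] =i pred0) (D : confAlg k)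
    (Z : choiceType) (z : Z -> D) (N : Z -> Z -> nat) (u : freemod k Z Z) :
  (forall a b n, (N a b <= n)%N -> (calg_mul (z a) (z b))@_n = 0) ->
  Mrel N u -> sfeval idfun (z : Z -> opmodule (alg_ops z)) u = 0.
Proof.
move=> hN; pose j : Z -> opmodule (alg_ops z) := z.
have hl : semilin idfun (sfeval idfun j) := sfeval_semilin _ _.
have hb b : sfeval idfun j (fbasis k Z b) = j b.
  by rewrite sfevalU scale1r.
have opL n a (v : opmodule (alg_ops z)) :
    Agen k (GL n a) *: v = Lop (@calg_mul k D) (z a) n v := opmod_gen _ _.
have opR n a (v : opmodule (alg_ops z)) :
    Agen k (GR n a) *: v = Rop (z a) n v := opmod_gen _ _.
move=> [[a [b [n [h ->]]]]|[a [b [m ->]]]].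
  by rewrite (semilinZ hl) hb opL /Lop hN // mul0rn.
pose c s : k := (-1) ^+ (m + s) / s`!%:R.
have e := semilin_flip (Agen k GD) (Agen k (GR m b))
  (fun s => Agen k (GL (m + s) a)) c (fbasis k Z a) (fbasis k Z b)
  ((N a b).+1 - m) hl.
apply: etrans e _; rewrite !hb opR.
apply/eqP; rewrite subr_eq0; apply/eqP.
rewrite /Rop (lflip_sum m char0 (hN a b)).
apply: eq_bigr => s _; rewrite opL.
exact: esym (opmod_poly _ _ _).
Qed.

Section HmodOps.
Context (k : fieldType) (Z : choiceType) (E : lmodType (algA k Z)).

Definition Hmod_ops : ops Z (Hmod E).
Proof.
apply: (@Ops k Z (Hmod E) (fun n z => gact (GL n z)) (fun n z => gact (GR n z))).
- by move=> n a c u v; rewrite gactD gactC.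
- by move=> n a c u v; rewrite gactD gactC.
- exact: gactL_del.
- exact: gactR_del.
- exact: gactRL.
Defined.
End HmodOps.

(** * The split null extension *)

Section SplitNullFacts.
Context (k : fieldType) (char0 : [pchar k] =i pred0) (X Y : choiceType).
Context (C : confAlg k) (M : confMod C) (i : X -> C) (j : Y -> M).
Local Notation z := (snull_gen i j).
Local Notation D := (snull M).
Local Notation OD := (alg_ops z).

Lemma snull_L n x (w : D) : Lop (@calg_mul k D) (z (inl x)) n w =
  (Lop (@calg_mul k C) (i x) n w.1, Lop (@cmod_act k C M) (i x) n w.2).
Proof.
rewrite /Lop snull_mulE /=; apply/eqP; rewrite -pair_eqE /pair_eq /=.
by rewrite (raddfMn fst) (raddfMn snd) /= !eqxx.
Qed.

(** The product of C + M depends on its left factor only through the C-component, which is 0 for the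
    generator y. *)
Lemma snull_Ly n y (w : D) : Lop (@calg_mul k D) (z (inr y)) n w = 0.
Proof.
rewrite /Lop snull_mulE /=.
have e1 : (calg_mul 0 w.1)@_n = 0.
  have := conf_linl (calg_axioms C) (-1) 0 0 w.1 n.
  by rewrite scaler0 addr0 polyCN scaleN1r addNr.
have e2 : (cmod_act (0 : C) w.2)@_n = 0.
  have := conf_linl (cmod_axioms M) (-1) 0 0 w.2 n.
  by rewrite scaler0 addr0 polyCN scaleN1r addNr.
by rewrite e1 e2; exact: mul0rn.
Qed.

Lemma snull_R n x (w : D) : Rop (z (inl x)) n w = (Rop (i x) n w.1, 0).
Proof.
have HM := cmod_axioms M.
have [K hK] := lpoly_bound (calg_mul w.1 (i x)).
have hK' m : (K <= m)%N -> (calg_mul w (z (inl x)))@_m = 0.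
  by move=> /hK h; rewrite snull_mulE /= h (conf0r HM).
rewrite /Rop (lflipEw _ hK) (lflipEw _ hK').
apply: pairP; rewrite /= ?(raddfMn fst) ?(raddfMn snd)
  ?(raddf_sum fst) ?(raddf_sum snd).
  by congr (_ *+ _); apply: eq_bigr => m _; rewrite snull_mulE.
by rewrite big1 ?mul0rn // => m _; rewrite snull_mulE /= (conf0r HM) scaler0.
Qed.

Lemma snull_locality N N' :
  (forall a b n, (N a b <= n)%N -> (calg_mul (i a) (i b))@_n = 0) ->
  (forall x y n, (N' x y <= n)%N -> (cmod_act (i x) (j y))@_n = 0) ->
  forall a b n, (snull_loc N N' a b <= n)%N ->
    (@calg_mul k D (z a) (z b))@_n = 0.
Proof.
move=> hC hM [x|y] b n h; last first.
  by apply: (factnI char0 (n := n)); rewrite mul0rn; exact: snull_Ly.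
case: b h => [x'|y'] /= h; rewrite snull_mulE /=.
  by rewrite hC // (conf0r (cmod_axioms M)).
by rewrite hM // (conf0r (calg_axioms C)).
Qed.

Definition snull_inC (c : opmodule (alg_ops i)) : opmodule OD := (c, 0).
Definition snull_inM (m : opmodule (mod_ops M i)) : opmodule OD := (0, m).

Lemma snull_inl : semilin (Amap (k := k) inl) snull_inC.
Proof.
apply: semilin_gens.
- by move=> u v; apply: pairP; rewrite /= ?addr0.
- move=> c v; rewrite !opmod_C.
  by apply: pairP; rewrite /= ?scaler0.
- move=> g v; rewrite !opmod_gen; case: g => [|n x|n x] /=.
  + by apply: pairP; rewrite /= ?scaler0.
  + rewrite snull_L /=; congr pair.
    by rewrite /Lop (conf0r (cmod_axioms M)) mul0rn.
  + by rewrite snull_R.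
Qed.

(** The convention that R_n^x is zero on M agrees with C + M, where right multiplication by (i x, 0)
    kills M. *)
Lemma snull_inr : semilin (Amap (k := k) inl) snull_inM.
Proof.
apply: semilin_gens.
- by move=> u v; apply: pairP; rewrite /= ?addr0.
- move=> c v; rewrite !opmod_C.
  by apply: pairP; rewrite /= ?scaler0.
- move=> g v; rewrite !opmod_gen; case: g => [|n x|n x] /=.
  + by apply: pairP; rewrite /= ?scaler0.
  + rewrite snull_L /=; congr pair.
    by rewrite /Lop (conf0r (calg_axioms C)) mul0rn.
  + rewrite snull_R /=; congr pair.
    apply/esym; rewrite /Rop /lflip big1 ?mul0rn // => m _.
    have := conf_linl (calg_axioms C) (-1) 0 0 (i x) m.
    by rewrite scaler0 addr0 polyCN scaleN1r addNr => ->; rewrite scaler0.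
Qed.

Lemma snull_rel_eq0 (N : X -> X -> nat) N' (S : set (freemod k X X))
    (T : set (freemod k X Y)) u :
  conf_alg_presented i N S -> satisfies i j N' T ->
  snull_rel S T u -> sfeval idfun (z : _ -> opmodule OD) u = 0.
Proof.
move=> [_ locC [f [[f' fK f'K] fi]]] [_ hT].
pose zz : X + Y -> opmodule OD := z.
have hl : semilin idfun (sfeval idfun zz) := sfeval_semilin _ _.
have hb b : zz b = sfeval idfun zz (fbasis k _ b) by rewrite sfevalU scale1r.
move=> [[[s Ss <-]|[t Tt <-]]|[y [n [v ->]]]].
- have e1 := idfun_sfeval (Amap inl) (fun x : X => fbasis k _ (inl x : X + Y)) s hl.
  have e2 := semilin_sfeval (i : X -> opmodule (alg_ops i)) s snull_inl.
  (* [S] vanishes in C: evaluation at the generators of C factors through the presented module,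
     because [f] matches generators. *)
  have e3 : sfeval idfun (i : X -> opmodule (alg_ops i)) s = 0.
    have fl : semilin idfun f by move=> a v w; rewrite linearP.
    pose ff v := f (presproj N S v).
    have ffl : semilin idfun ff.
      by move=> a v w; rewrite /ff (presproj_semilin N S) fl.
    have -> : sfeval idfun (i : X -> opmodule (alg_ops i)) s = ff s.
      move: s {Ss e1 e2}; apply: malg_ind => [|v w hv hw|a x].
      + by rewrite (semilin0 ffl) (semilin0 (sfeval_semilin _ _)).
      + by rewrite (semilinD ffl) -hv -hw (semilinD (sfeval_semilin _ _)).
      + by rewrite sfevalU malgUZ (semilinZ ffl); congr (_ *: _); rewrite -fi.
    by rewrite /ff presproj_rel // (semilin0 fl).
  apply: etrans e1 _; rewrite e3 in e2.
  apply: etrans (esym _) (esym e2).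
  by apply: eq_bigr => x _; rewrite /= -hb.
- have e1 := idfun_sfeval (Amap inl) (fun y : Y => fbasis k _ (inr y : X + Y)) t hl.
  have e2 := semilin_sfeval (j : Y -> opmodule (mod_ops M i)) t snull_inr.
  have e3 : sfeval idfun (j : Y -> opmodule (mod_ops M i)) t = 0 := hT t Tt.
  apply: etrans e1 _; rewrite e3 in e2.
  apply: etrans (esym _) (esym e2).
  by apply: eq_bigr => x _; rewrite /= -hb.
- by rewrite (semilinZ hl) opmod_gen; exact: snull_Ly.
Qed.

(** A subalgebra containing the generators contains C + 0; it then contains 0 + M, since the
    products of (a, 0) with (0, v) realise the action of C on M. *)
Lemma snull_generated :
  smallest (@is_conf_subalg k C) (range i) = setT ->
  smallest (@is_conf_submod k C M) (range j) = setT ->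
  smallest (@is_conf_subalg k D) (range z) = setT.
Proof.
move=> genC genM; rewrite -subTset => -[c m] _ P [[HP hP] hz].
have PD (u v : D) : P u -> P v -> P (u + v) by exact: submodD.
have Pc c' : P (c', 0).
  suff : setT `<=` (fun c' => P (c', 0)) by apply.
  rewrite -genC; apply: smallest_sub; last first.
    by move=> _ [x _ <-]; apply: hz; exists (inl x).
  split; first split=> [|a u v hu hv]; first exact: submod0 HP.
    have := HP.2 a _ _ hu hv; congr P.
    by apply: pairP; rewrite /= ?scaler0 ?addr0.
  move=> a b n ha hb; have := hP _ _ n ha hb; rewrite snull_mulE /=.
  by rewrite (conf0r (cmod_axioms M)).
have Pm m' : P (0, m').
  suff : setT `<=` (fun m' => P (0, m')) by apply.
  rewrite -genM; apply: smallest_sub; last first.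
    by move=> _ [y _ <-]; apply: hz; exists (inr y).
  split; first split=> [|a u v hu hv]; first exact: submod0 HP.
    have := HP.2 a _ _ hu hv; congr P.
    by apply: pairP; rewrite /= ?scaler0 ?addr0.
  move=> a v n hv; have := hP _ _ n (Pc a) hv; rewrite snull_mulE /=.
  by rewrite (conf0r (calg_axioms C)).
have := PD _ _ (Pc c) (Pm m); congr P.
by apply: pairP; rewrite /= ?addr0 ?add0r.
Qed.
End SplitNullFacts.

(** * The conformal module structure on the quotient of M(X + Y, N) *)

Section ModuleExtension.
Context (k : fieldType) (char0 : [pchar k] =i pred0) (X Y : choiceType).
Context (C : confAlg k) (i : X -> C) (N : X -> X -> nat) (N' : X -> Y -> nat).
Hypothesis gen : smallest (@is_conf_subalg k C) (range i) = setT.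
Local Notation mul := (@calg_mul k C).
Local Notation Z := (X + Y)%type.
Local Notation NZ := (snull_loc N N').
Let HC := calg_axioms C.

(** [U] stands for the quotient of M(X + Y, N) over H, [g] for the map from C and [e] for the images
    of the generators. *)
Context (U : lmodType {poly k}) (o : ops Z U) (g : C -> U) (e : Z -> U).
Hypothesis glin : forall p u v, g (p *: u + v) = p *: g u + g v.
Hypothesis gL : forall x n u, g (Lop mul (i x) n u) = opL o n (inl x) (g u).
Hypothesis gR : forall x n u, g (Rop (i x) n u) = opR o n (inl x) (g u).
Hypothesis gi : forall x, g (i x) = e (inl x).
Hypothesis eL : forall a b n, (NZ a b <= n)%N -> opL o n a (e b) = 0.
Hypothesis eR : forall a b m, opR o m b (e a) = \sum_(s < (NZ a b).+1 - m)
  (((-1) ^+ (m + s) / (s`!)%:R : k)%:P * 'X^s) *: opL o (m + s) a (e b).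
Hypothesis Ly0 : forall n y u, opL o n (inr y) u = 0.
Hypothesis Uind : forall P : set U, is_submod P ->
  (forall n z u, P u -> P (opL o n z u)) ->
  (forall n z u, P u -> P (opR o n z u)) ->
  (forall z, P (e z)) -> forall u, P u.

Lemma gD u v : g (u + v) = g u + g v.
Proof. by have := glin 1 u v; rewrite !scale1r. Qed.

Lemma g0 : g 0 = 0.
Proof. by have := glin (-1) 0 0; rewrite scaler0 addr0 scaleN1r addNr. Qed.

Lemma gZ p u : g (p *: u) = p *: g u.
Proof. by have := glin p u 0; rewrite g0 !addr0. Qed.

Lemma gMn u n : g (u *+ n) = g u *+ n.
Proof. by elim: n => [|n IH]; rewrite ?mulr0n ?g0 // !mulrS gD IH. Qed.

Lemma g_hev h (p : {lpoly C}) (q : {lpoly U}) : (forall n, q@_n = g p@_n) ->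
  g (hev h p) = hev h q.
Proof. by apply: hev_map; [exact: g0|exact: gD|move=> n v; exact: gZ]. Qed.

Lemma eL_lpoly x y : exists q : {lpoly U},
  forall n, opL o n (inl x) (e (inr y)) = q@_n *+ n`!.
Proof.
by apply: (@fact_lpoly _ char0 _ _ (N' x y)) => n h; rewrite eL.
Qed.

Lemma eR_lflip x y (q : {lpoly U}) m :
    (forall n, opL o n (inl x) (e (inr y)) = q@_n *+ n`!) ->
  opR o m (inr y) (g (i x)) = lflip q m *+ m`!.
Proof.
move=> hq; rewrite gi eR /= (@lflip_sum _ _ q (N' x y)) //.
  by apply: eq_bigr => s _; rewrite hq.
by move=> n h; apply: (factnI char0 (n := n)); rewrite -hq eL // mul0rn.
Qed.

Lemma R_lpoly_submod y : is_submod (fun c => exists p : {lpoly U},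
  forall n, opR o n (inr y) (g c) = p@_n *+ n`!).
Proof.
apply: submod_poly.
- by exists 0 => n; rewrite g0 opR0 mcoeff0 mul0rn.
- move=> u v [p hp] [q hq]; exists (p + q) => n.
  by rewrite gD opRD hp hq mcoeffD mulrnDl.
- move=> c v [p hp]; have [K hK] := lpoly_bound p.
  apply: (@fact_lpoly _ char0 _ _ K) => n /hK e0.
  by rewrite gZ opRC hp e0 mul0rn scaler0.
- move=> v [p hp]; have [K hK] := lpoly_bound p.
  apply: (@fact_lpoly _ char0 _ _ K.+1) => n hn.
  rewrite gZ opR_del !hp !hK ?mul0rn ?scaler0 ?addr0 ?mul0rn //; last exact: ltnW.
  by case: n hn.
Qed.

(** On a generator x the values R_m^y g(x) are the flip of L_n^x y, which is a polynomial by
    locality; L_n^x commutes with R_m^y, so the bound on m survives left multiplication. *)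
Lemma R_lpoly y c : exists p : {lpoly U},
  forall n, opR o n (inr y) (g c) = p@_n *+ n`!.
Proof.
move: c; apply: (conf_algP_Lop char0 gen (R_lpoly_submod y)).
  move=> x; have [q hq] := eL_lpoly x y; have [K hK] := lpoly_bound q.
  apply: (@fact_lpoly _ char0 _ _ K) => m hm; rewrite (eR_lflip m hq).
  rewrite (lflipEw _ hK) big_nat big1 ?mul0rn // => n /andP[_ hn].
  by rewrite bin_small ?mulr0n ?scale0r //; exact: leq_trans hm.
move=> x v n [p hp]; have [K hK] := lpoly_bound p.
apply: (@fact_lpoly _ char0 _ _ K) => m /hK e0.
by rewrite gL opRL hp e0 mul0rn opL0.
Qed.

(** The future (c_(- lambda - d) y) = sum_n lambda^n / n! R_n^y g(c), available before C acts on
    [U]. *)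
Definition Rp y c : {lpoly U} := projT1 (cid (R_lpoly y c)).

Lemma RpE y c n : opR o n (inr y) (g c) = (Rp y c)@_n *+ n`!.
Proof. by rewrite /Rp; case: cid. Qed.

Lemma RpP y c n v : opR o n (inr y) (g c) = v *+ n`! -> (Rp y c)@_n = v.
Proof. by rewrite RpE; exact: factnI. Qed.

Lemma Rp_lin y (c : k) u v n :
  (Rp y (c%:P *: u + v))@_n = c%:P *: (Rp y u)@_n + (Rp y v)@_n.
Proof.
by apply: RpP; rewrite glin opR_lin !RpE mulrnDl scalerMnr.
Qed.

Lemma Rp_del y u n :
  (Rp y ('X *: u))@_n = 'X *: (Rp y u)@_n + lmulX (Rp y u) n.
Proof.
apply: RpP; rewrite gZ opR_del !RpE mulrnDl scalerMnr; congr (_ + _).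
case: n => [|n] /=; rewrite ?mulr0n ?mul0rn //.
by rewrite factS mulnC mulrnA.
Qed.

(* (c_(h) y) = (R^y_(- h - d)) c *)
Definition rho y (h : {poly k}) (c : C) : U := hev (- (h + 'X)) (Rp y c).

Lemma rho_lin y h (c : k) u v :
  rho y h (c%:P *: u + v) = c%:P *: rho y h u + rho y h v.
Proof. by apply: hev_lin => n; rewrite Rp_lin. Qed.

Lemma rho_del y h u : rho y h ('X *: u) = - (h *: rho y h u).
Proof.
have [q hq] := lmulX_lpoly (Rp y u).
rewrite /rho (@hev_lin _ _ _ 'X (Rp y u) q) => [|n]; last by rewrite Rp_del hq.
by rewrite (hev_lmulX _ hq) -scalerDl opprD addrCA subrr addr0 scaleNr.
Qed.

(** The flip is an involution: flipping the polynomial of R^y on g(x) returns the polynomial of L^x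
    on y. *)
Lemma rho_i y h x (q : {lpoly U}) :
    (forall n, opL o n (inl x) (e (inr y)) = q@_n *+ n`!) ->
  rho y h (i x) = hev h q.
Proof.
move=> hq; rewrite /rho (@hev_lflip _ _ _ q) => [|n].
  by rewrite opprD opprK addrK.
by apply: RpP; exact: eR_lflip.
Qed.

(** The locality function is 0 on Y x (X + Y), so every term L_n^y e(z) in [eR] vanishes. *)
Lemma e_kerR y : kerR o (e (inr y)).
Proof.
by move=> m z; rewrite eR big1 // => s _; rewrite eL ?scaler0.
Qed.

(** For a generator x, R_m^y g(x) is an H-combination of the L_n^x y, which lie in the common kernel
    by [e_kerR] and [kerR_L]; left multiplication by generators preserves the property since L
    commutes with R. *)
Lemma R_kerR y m c : kerR o (opR o m (inr y) (g c)).
Proof.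
pose P c := forall m y, kerR o (opR o m (inr y) (g c)).
have HK := kerR_submod o.
suff : P c by [].
apply: (conf_algP_Lop char0 gen) => {c} [|x|x v n Pv].
- apply: submod_poly.
  + by move=> n w; rewrite g0 opR0; exact: submod0.
  + by move=> u v hu hv n w; rewrite gD opRD; exact: (submodD HK (hu _ _) (hv _ _)).
  + by move=> c v hv n w; rewrite gZ opRC; exact: (submodZ _ HK (hv _ _)).
  + move=> v hv n w; rewrite gZ opR_del; apply: (submodD HK).
      exact: (submodZ _ HK (hv _ _)).
    exact: (submodMn _ HK (hv _ _)).
- move=> n w; rewrite gi eR; apply: (submod_sum HK) => s _; apply: (submodZ _ HK).
  by apply: kerR_L; exact: e_kerR.
- by move=> p w; rewrite gL opRL; apply: kerR_L; exact: Pv.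
Qed.

(** The H-span [Q] of the three kinds of vectors is closed under all L and R and contains the
    generators, hence is everything. The induction runs on [Q] because [P] itself need not be stable
    under L and R. *)
Lemma U_span (P : set U) : is_submod P -> (forall c, P (g c)) ->
  (forall y, P (e (inr y))) -> (forall y m c, P (opR o m (inr y) (g c))) ->
  forall u, P u.
Proof.
move=> HP Pg Pe PR.
pose G : set U := [set u | [\/ exists c, u = g c, exists y, u = e (inr y) |
  exists y m c, u = opR o m (inr y) (g c)]].
have HQ := submod_genP G; pose Q := submod_gen G.
have Qg c : Q (g c) by apply: sub_gen_smallest; apply: Or31; exists c.
have Qe y : Q (e (inr y)) by apply: sub_gen_smallest; apply: Or32; exists y.
have QR y m c : Q (opR o m (inr y) (g c)).
  by apply: sub_gen_smallest; apply: Or33; exists y, m, c.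
(* L_n^x y is not among the spanning vectors, but its lambda-polynomial is a flip of the R_m^y g(x),
   so its values, and then its coefficients, lie in [Q]. *)
have QLe n x y : Q (opL o n (inl x) (e (inr y))).
  have [q hq] := eL_lpoly x y; rewrite hq; apply: (submodMn _ HQ).
  apply: (hev_coef char0 HQ) => c; rewrite -(rho_i _ hq).
  apply: (submod_hev _ HQ) => m; apply: (submod_natI char0 (n := m`!.-1) HQ).
  by rewrite prednK ?fact_gt0 // -RpE; exact: QR.
have sub (P' : set U) : is_submod P' -> G `<=` P' -> Q `<=` P'.
  by move=> HP' GP' u; apply; split.
suff QT u : Q u.
  move=> u; apply: (sub P HP _ u (QT u)).
  by move=> _ [[c ->]|[y ->]|[y [m [c ->]]]].
move: u; apply: (Uind HQ).
- move=> n z u Qu; apply: (sub _ (opL_submod o HQ) _ u Qu) => {n z u Qu}.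
  move=> _ [[c ->]|[y ->]|[y [m [c ->]]]] n [x|y'];
    rewrite ?Ly0; try exact: (submod0 HQ).
  + by rewrite -gL; exact: Qg.
  + exact: QLe.
  + by rewrite -opRL -gL; exact: QR.
- move=> n z u Qu; apply: (sub _ (opR_submod o HQ) _ u Qu) => {n z u Qu}.
  move=> _ [[c ->]|[y ->]|[y [m [c ->]]]] n z.
  + by case: z => [x|y]; [rewrite -gR; exact: Qg|exact: QR].
  + by rewrite e_kerR; exact: (submod0 HQ).
  + by rewrite R_kerR; exact: (submod0 HQ).
- by case=> [x|y]; [rewrite -gi; exact: Qg|exact: Qe].
Qed.

(** On the spanning vectors of [U_span] the bound comes from the product of C, from locality, and
    from L commuting with R. *)
Lemma L_lpoly x u : exists p : {lpoly U},
  forall n, opL o n (inl x) u = p@_n *+ n`!.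
Proof.
move: u; apply: U_span.
- apply: submod_poly.
  + by exists 0 => n; rewrite opL0 mcoeff0 mul0rn.
  + move=> u v [p hp] [q hq]; exists (p + q) => n.
    by rewrite opLD hp hq mcoeffD mulrnDl.
  + move=> c v [p hp]; have [K hK] := lpoly_bound p.
    apply: (@fact_lpoly _ char0 _ _ K) => n /hK e0.
    by rewrite opLC hp e0 mul0rn scaler0.
  + move=> v [p hp]; have [K hK] := lpoly_bound p.
    apply: (@fact_lpoly _ char0 _ _ K.+1) => n hn.
    rewrite opL_del !hp !hK ?mul0rn ?scaler0 ?addr0 ?mul0rn //; last exact: ltnW.
    by case: n hn.
- move=> c; have [K hK] := lpoly_bound (mul (i x) c).
  apply: (@fact_lpoly _ char0 _ _ K) => n /hK e0.
  by rewrite -gL /Lop e0 mul0rn g0.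
- move=> y; exact: eL_lpoly.
- move=> y m c; have [K hK] := lpoly_bound (mul (i x) c).
  apply: (@fact_lpoly _ char0 _ _ K) => n /hK e0.
  by rewrite -opRL -gL /Lop e0 mul0rn g0 opR0.
Qed.

Definition Lp x u : {lpoly U} := projT1 (cid (L_lpoly x u)).

Lemma LpE x u n : opL o n (inl x) u = (Lp x u)@_n *+ n`!.
Proof. by rewrite /Lp; case: cid. Qed.

Lemma LpP x u n v : opL o n (inl x) u = v *+ n`! -> (Lp x u)@_n = v.
Proof. by rewrite LpE; exact: factnI. Qed.

(* The properties forced on the map phi(a) = (c_(a) -) by the generators of [U]
   as an H-module, see [U_span]. *)
Record represents (c : C) (phi : k -> U -> U) : Prop := {
  repD : forall a u v, phi a (u + v) = phi a u + phi a v;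
  repC : forall a (b : k) u, phi a (b%:P *: u) = b%:P *: phi a u;
  repX : forall a u, phi a ('X *: u) = ('X + a%:P) *: phi a u;
  repg : forall a v, phi a (g v) = g (hev a%:P (mul c v));
  repR : forall a y m v, phi a (opR o m (inr y) (g v)) =
    opR o m (inr y) (g (hev a%:P (mul c v)));
  repe : forall a y, phi a (e (inr y)) = rho y a%:P c;
  rep_poly : forall u, polyfun (phi^~ u)
}.

Section Represents.
Context (c : C) (phi : k -> U -> U) (Hphi : represents c phi).

Lemma rep0 a : phi a 0 = 0.
Proof. by rewrite -[in LHS](scale0r 0) -polyC0 (repC Hphi) polyC0 scale0r. Qed.

Lemma repN a u : phi a (- u) = - phi a u.
Proof. by apply/eqP; rewrite -addr_eq0 -(repD Hphi) addNr rep0. Qed.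

Lemma repMn a u n : phi a (u *+ n) = phi a u *+ n.
Proof.
by elim: n => [|n IH]; rewrite ?mulr0n ?rep0 // !mulrS (repD Hphi) IH.
Qed.

Lemma repXn a (b : k) n u :
  phi a ((- (b%:P + 'X)) ^+ n *: u) = (- ((a + b)%:P + 'X)) ^+ n *: phi a u.
Proof.
elim: n u => [|n IH] u; first by rewrite !expr0 !scale1r.
rewrite !exprSr -!scalerA IH; congr (_ *: _).
rewrite !scaleNr repN scalerDl (repD Hphi) (repC Hphi) (repX Hphi) -scalerDl.
by rewrite addrCA -polyCD [b + a]addrC ['X + _]addrC.
Qed.

(** Associativity c_(a) (v_(b) y) = (c_(a) v)_(a + b) y: phi(a) commutes with R_m^y along [g], and
    turning d into d + a shifts the point - b - d to - (a + b) - d. *)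
Lemma rep_rho a y (b : k) v :
  phi a (rho y b%:P v) = rho y (a + b)%:P (hev a%:P (mul c v)).
Proof.
rewrite /rho; apply: hev_map; [exact: rep0|exact: (repD Hphi _)|exact: repXn|] => n.
by apply: RpP; rewrite -(repR Hphi) RpE repMn.
Qed.

Lemma rep_polyfun a (f : k -> U) : polyfun f -> polyfun (fun b => phi a (f b)).
Proof.
move=> [p hp]; have [K hK] := lpoly_bound p.
have [q hq] : exists q : {lpoly U}, forall n, q@_n = phi a p@_n.
  by apply: (@mk_lpoly0 _ _ _ K) => n /hK->; exact: rep0.
exists q => b; rewrite hp; apply: hev_map hq; [exact: rep0|exact: (repD Hphi _)|].
by move=> n v; rewrite -rmorphXn (repC Hphi).
Qed.
End Represents.

Lemma represents_uniq c phi psi a u :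
  represents c phi -> represents c psi -> phi a u = psi a u.
Proof.
move=> Hp Hs; move: u; apply: U_span.
- apply: submod_poly.
  + by rewrite (rep0 Hp) (rep0 Hs).
  + by move=> u v hu hv; rewrite (repD Hp) (repD Hs) hu hv.
  + by move=> b v hv; rewrite (repC Hp) (repC Hs) hv.
  + by move=> v hv; rewrite (repX Hp) (repX Hs) hv.
- by move=> v; rewrite (repg Hp) (repg Hs).
- by move=> y; rewrite (repe Hp) (repe Hs).
- by move=> y m v; rewrite (repR Hp) (repR Hs).
Qed.

Lemma represents_lin (b : k) c d phi psi : represents c phi -> represents d psi ->
  represents (b%:P *: c + d) (fun a u => b%:P *: phi a u + psi a u).
Proof.
have e1 a v : hev a%:P (mul (b%:P *: c + d) v) =
    b%:P *: hev a%:P (mul c v) + hev a%:P (mul d v).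
  by rewrite (ev_addl HC) (ev_Cl HC).
move=> Hp Hs; split.
- by move=> a u v; rewrite (repD Hp) (repD Hs) scalerDr addrACA.
- move=> a b' u; rewrite (repC Hp) (repC Hs) scalerDr !scalerA.
  by rewrite [b%:P * _]mulrC.
- move=> a u; rewrite (repX Hp) (repX Hs) [RHS]scalerDr !scalerA.
  by rewrite [b%:P * _]mulrC.
- by move=> a v; rewrite (repg Hp) (repg Hs) e1 glin.
- by move=> a y m v; rewrite (repR Hp) (repR Hs) e1 glin opR_lin.
- by move=> a y; rewrite (repe Hp) (repe Hs) rho_lin.
- by move=> u; apply: polyfunD (rep_poly Hs u); apply: polyfunZ (rep_poly Hp u).
Qed.

Lemma represents_del c phi : represents c phi ->
  represents ('X *: c) (fun a u => - (a%:P *: phi a u)).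
Proof.
move=> Hp; split.
- by move=> a u v; rewrite (repD Hp) scalerDr opprD.
- by move=> a b u; rewrite (repC Hp) !scalerN !scalerA [b%:P * _]mulrC.
- by move=> a u; rewrite (repX Hp) !scalerN !scalerA [_ * a%:P]mulrC.
- by move=> a v; rewrite (repg Hp) (ev_Xl HC) -scaleNr -gZ scaleNr.
- move=> a y m v; rewrite (repR Hp) (ev_Xl HC) -!scaleNr -polyCN.
  by rewrite gZ opRC.
- by move=> a y; rewrite (repe Hp) rho_del.
- move=> u; rewrite /=; have h := polyfunX (rep_poly Hp u).
  by apply: polyfun_ext (polyfunZ (-1) h) => a; rewrite scaleN1r.
Qed.

(** The family is dictated by associativity in the form (c_(a) d)_(b) u = c_(a) (d_(b - a) u). *)
Lemma represents_mul c d phi psi a : represents c phi -> represents d psi ->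
  represents (hev a%:P (mul c d)) (fun b u => phi a (psi (b - a) u)).
Proof.
move=> Hp Hs.
have e1 b v : hev a%:P (mul c (hev (b - a)%:P (mul d v))) =
    hev b%:P (mul (hev a%:P (mul c d)) v).
  by rewrite (ev_assoc HC) [a + _]addrC subrK.
split.
- by move=> b u v; rewrite (repD Hs) (repD Hp).
- by move=> b b' u; rewrite (repC Hs) (repC Hp).
- move=> b u; rewrite (repX Hs) scalerDl (repD Hp) (repX Hp) (repC Hp) -scalerDl.
  by rewrite -addrA -polyCD [a + _]addrC subrK.
- by move=> b v; rewrite (repg Hs) (repg Hp) e1.
- by move=> b y m v; rewrite (repR Hs) (repR Hp) e1.
- by move=> b y; rewrite (repe Hs) (rep_rho Hp) [a + _]addrC subrK.
- move=> u; apply: (rep_polyfun Hp); have [p hp] := rep_poly Hs u.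
  by apply: polyfun_ext (polyfun_shift (- a%:P) p) => b; rewrite hp polyCB.
Qed.

Lemma represents_gen x : represents (i x) (fun a u => hev a%:P (Lp x u)).
Proof.
split.
- move=> a u v; rewrite -[hev _ (Lp x u)]scale1r; apply: hev_lin => n.
  by apply: LpP; rewrite opLD !LpE scale1r mulrnDl.
- move=> a b u; apply: hevZ => n; apply: LpP.
  by rewrite opLC LpE scalerMnr.
- move=> a u; have [q hq] := lmulX_lpoly (Lp x u).
  rewrite scalerDl -(hev_lmulX _ hq); apply: hev_lin => n; rewrite hq.
  apply: LpP; rewrite opL_del !LpE mulrnDl scalerMnr; congr (_ + _).
  case: n => [|n] /=; rewrite ?mulr0n ?mul0rn //.
  by rewrite factS mulnC mulrnA.
- move=> a v; apply/esym/g_hev => n; apply: LpP.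
  by rewrite -gL /Lop gMn.
- move=> a y m v; apply/esym.
  apply: (hev_map (F := fun w => opR o m (inr y) (g w))).
  + by rewrite g0 opR0.
  + by move=> u w; rewrite gD opRD.
  + by move=> n w; rewrite -rmorphXn gZ opRC.
  + by move=> n; apply: LpP; rewrite -opRL -gL /Lop gMn opRMn.
- by move=> a y; apply/esym/rho_i => n; rewrite LpE.
- by move=> u; exact: polyfun_hev.
Qed.

Lemma represents_ex c : exists phi, represents c phi.
Proof.
suff : setT `<=` (fun c => exists phi, represents c phi) by apply.
rewrite -gen; apply: smallest_sub; last first.
  by move=> _ [x _ <-]; eexists; exact: represents_gen.
apply: (ev_subalg char0); last first.
  move=> a b d [phi Hp] [psi Hs].
  by eexists; exact: represents_mul d Hp Hs.
have h0 : represents 0 (fun _ _ => 0).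
  split=> [a u v|a b u|a u|a v|a y m v|a y|u].
  - by rewrite addr0.
  - by rewrite scaler0.
  - by rewrite scaler0.
  - by rewrite (ev_0l HC) g0.
  - by rewrite (ev_0l HC) g0 opR0.
  - rewrite /rho (@hev0 _ _ _ (Rp y 0)) // => n; apply: RpP.
    by rewrite g0 opR0 mul0rn.
  - exact: polyfunC.
apply: submod_poly.
- by eexists; exact: h0.
- move=> u v [phi Hp] [psi Hs]; exists (fun a w => 1%:P *: phi a w + psi a w).
  by have := represents_lin 1 Hp Hs; rewrite scale1r.
- move=> b v [phi Hp]; exists (fun a w => b%:P *: phi a w + 0).
  by have := represents_lin b Hp h0; rewrite addr0.
- by move=> v [phi Hp]; eexists; exact: represents_del Hp.
Qed.

(** Each identity in the acting element compares two families representing the same element of C, so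
    it follows from [represents_uniq]; the identities in the vector are fields of [represents]. *)
Lemma module_extension : exists act : C -> U -> {lpoly U},
  is_conformal mul act /\
  forall x n u, (act (i x) u)@_n *+ n`! = opL o n (inl x) u.
Proof.
have [rep Hrep] := choice represents_ex.
pose act c u := projT1 (cid (rep_poly (Hrep c) u)).
have actE c a u : hev a%:P (act c u) = rep c a u.
  by rewrite /act; case: cid.
(* Linear identities between coefficients may be checked on values at scalars. *)
have coef (b : k) (p q r : {lpoly U}) n :
    (forall a : k, hev a%:P r = b%:P *: hev a%:P p + hev a%:P q) ->
    r@_n = b%:P *: p@_n + q@_n.
  move=> h; have [K hK] := lpoly_bound2 p q.
  have [s hs] : exists s : {lpoly U}, forall n, s@_n = b%:P *: p@_n + q@_n.
    by apply: (@mk_lpoly0 _ _ _ K) => m /hK[-> ->]; rewrite scaler0 addr0.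
  rewrite -hs; congr mcoeff; apply: (hev_inj char0) => a.
  by rewrite h (hev_lin _ hs).
have linl (b : k) c d u n : (act (b%:P *: c + d) u)@_n =
    b%:P *: (act c u)@_n + (act d u)@_n.
  apply: coef => a; rewrite !actE.
  exact: represents_uniq (Hrep _) (represents_lin b (Hrep c) (Hrep d)).
have linr (b : k) c u v n : (act c (b%:P *: u + v))@_n =
    b%:P *: (act c u)@_n + (act c v)@_n.
  by apply: coef => a; rewrite !actE (repD (Hrep c)) (repC (Hrep c)).
exists act; split; last first.
  move=> x n u; rewrite LpE; congr (_ *+ _); congr mcoeff.
  apply: (hev_inj char0) => a; rewrite actE.
  exact: represents_uniq (Hrep _) (represents_gen x).
split=> //.
- move=> c u n; have [s hs] := lmulX_lpoly (act c u).
  have -> : (act ('X *: c) u)@_n = (-1)%:P *: s@_n + (0 : {lpoly U})@_n.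
    apply: coef => a; rewrite !actE (hev_lmulX _ hs) actE (@hev0 _ _ _ 0) => [|m].
      rewrite addr0 polyCN polyC1 scaleN1r.
      exact: represents_uniq (Hrep _) (represents_del (Hrep c)).
    exact: mcoeff0.
  by rewrite mcoeff0 addr0 polyCN polyC1 scaleN1r hs.
- move=> c u n; have [s hs] := lmulX_lpoly (act c u); rewrite -hs.
  have [p hp] : exists p : {lpoly U}, forall n, p@_n = 'X *: (act c u)@_n.
    have [K hK] := lpoly_bound (act c u).
    by apply: (@mk_lpoly0 _ _ _ K) => m /hK->; rewrite scaler0.
  rewrite -hp -[p@_n]scale1r -polyC1; apply: coef => a.
  rewrite polyC1 scale1r (hevZ _ hp) (hev_lmulX _ hs) !actE (repX (Hrep c)).
  by rewrite scalerDl.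
- apply: (conf_of_ev_assoc linl linr char0) => a b c d u.
  rewrite !actE.
  have := represents_uniq (a + b) u (Hrep _)
    (represents_mul a (Hrep c) (Hrep d)).
  by rewrite [a + b]addrC addrK => ->.
Qed.

(** * The bijection between the quotient and C + M *)

Section Bijectivity.
Context (M : confMod C) (j : Y -> M) (h : U -> snull M) (mh : M -> U).
Hypothesis genM : smallest (@is_conf_submod k C M) (range j) = setT.
Hypothesis hlin : forall p u v, h (p *: u + v) = p *: h u + h v.
Hypothesis hL : forall n x u, h (opL o n (inl x) u) =
  Lop (@calg_mul k (snull M)) (snull_gen i j (inl x)) n (h u).
Hypothesis he : forall z, h (e z) = snull_gen i j z.
Hypothesis mlin : forall p u v, mh (p *: u + v) = p *: mh u + mh v.
Hypothesis mL : forall x n v,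
  mh (Lop (@cmod_act k C M) (i x) n v) = opL o n (inl x) (mh v).
Hypothesis me : forall y, mh (j y) = e (inr y).

Let hD u v : h (u + v) = h u + h v.
Proof. by have := hlin 1 u v; rewrite !scale1r. Qed.
Let h0 : h 0 = 0.
Proof. by have := hlin (-1) 0 0; rewrite scaler0 addr0 scaleN1r addNr. Qed.
Let hMn u n : h (u *+ n) = h u *+ n.
Proof. by elim: n => [|n IH]; rewrite ?mulr0n ?h0 // !mulrS hD IH. Qed.
Let mD u v : mh (u + v) = mh u + mh v.
Proof. by have := mlin 1 u v; rewrite !scale1r. Qed.
Let m0 : mh 0 = 0.
Proof. by have := mlin (-1) 0 0; rewrite scaler0 addr0 scaleN1r addNr. Qed.
Let mMn u n : mh (u *+ n) = mh u *+ n.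
Proof. by elim: n => [|n IH]; rewrite ?mulr0n ?m0 // !mulrS mD IH. Qed.

Let hg c : h (g c) = (c, 0).
Proof.
move: c; apply: (conf_algP_Lop char0 gen).
- split=> [|p u v hu hv]; first by rewrite g0 h0.
  rewrite glin hlin hu hv.
  by apply: pairP; rewrite /= ?scaler0 ?addr0.
- by move=> x; rewrite gi he.
- move=> x v n hv; rewrite gL hL hv snull_L /=; congr pair.
  by rewrite /Lop (conf0r (cmod_axioms M)) mul0rn.
Qed.

Let hm m : h (mh m) = (0, m).
Proof.
suff : setT `<=` (fun m => h (mh m) = (0, m)) by apply.
rewrite -genM; apply: smallest_sub; last by move=> _ [y _ <-]; rewrite me he.
apply: (conf_submodP char0 gen).
- split=> [|p u v hu hv]; first by rewrite m0 h0.
  rewrite mlin hlin hu hv.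
  by apply: pairP; rewrite /= ?scaler0 ?addr0.
- move=> x v n hv; apply: (factnI char0 (n := n)).
  rewrite -hMn -mMn -/(Lop _ _ _ _) mL hL hv snull_L /=.
  rewrite /Lop (conf0r (calg_axioms C)).
  by apply: pairP; rewrite /= ?(raddfMn fst) ?(raddfMn snd) /=.
Qed.

(** For a generator x, R_n^y g(x) is an H-combination of the L_m^x y, which lie in the image of M;
    that image is stable under L_m^x, which commutes with R_n^y. *)
Let im_R y n c : exists m, opR o n (inr y) (g c) = mh m.
Proof.
pose I : set U := fun u => exists m, u = mh m.
have HI : is_submod I.
  split=> [|p _ _ [u ->] [v ->]]; first by exists 0; rewrite m0.
  by exists (p *: u + v); rewrite mlin.
suff : forall n y, I (opR o n (inr y) (g c)) by apply.
move: c; apply: (conf_algP_Lop char0 gen).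
- apply: submod_poly.
  + by move=> m w; rewrite g0 opR0; exact: submod0.
  + by move=> u v hu hv m w; rewrite gD opRD; exact: (submodD HI).
  + by move=> c v hv m w; rewrite gZ opRC; exact: (submodZ _ HI).
  + move=> v hv m w; rewrite gZ opR_del; apply: (submodD HI).
      exact: (submodZ _ HI).
    exact: (submodMn _ HI).
- move=> x m w; rewrite gi eR; apply: (submod_sum HI) => s _.
  by apply: (submodZ _ HI); rewrite -me -mL; eexists.
- by move=> x v m hv p w; have [u hu] := hv p w; rewrite gL opRL hu -mL; eexists.
Qed.

Lemma extension_bij : bijective h.
Proof.
pose r (w : C * M) := g w.1 + mh w.2.
have hr : cancel r h.
  move=> [c m]; rewrite /r hD hg hm.
  by apply: pairP; rewrite /= ?addr0 ?add0r.
(* The vectors R_n^y g(c) are covered by the M-component, so the image of [r] contains the spanning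
   set of [U_span]. *)
have r_surj : forall u, exists w, u = r w.
  apply: U_span.
  - split=> [|p _ _ [[c m] ->] [[c' m'] ->]].
      by exists (0, 0); rewrite /r g0 m0 addr0.
    by exists (p *: c + c', p *: m + m'); rewrite /r /= glin mlin scalerDr addrACA.
  - by move=> c; exists (c, 0); rewrite /r /= m0 addr0.
  - by move=> y; exists (0, j y); rewrite /r /= g0 add0r me.
  - move=> y n c; have [m hm'] := im_R y n c.
    by exists (0, m); rewrite /r /= g0 add0r.
exists r => // u; have [w ->] := r_surj u.
by rewrite hr.
Qed.
End Bijectivity.
End ModuleExtension.

(** In [mod_ops] the R_n^x are zero by decree, while on [E] they are the given operators. The two
    actions agree on [K], where the latter vanish, and [K] is stable under d and L, so the agreement
    extends to all words. *)
Lemma mod_ops_Amap (k : fieldType) (X Z : choiceType) (f : X -> Z)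
    (E : lmodType (algA k Z)) (C : confAlg k) (i : X -> C) (M : confMod C)
    (h : opmodule (mod_ops M i) -> E) (K : set (Hmod E)) :
  is_submod K -> (forall n x u, K u -> K (gact (GL n (f x)) u)) ->
  (forall n x u, K u -> gact (GR n (f x)) u = 0) ->
  (forall u v, h (u + v) = h u + h v) ->
  (forall p u, h (p *: u : M) = (p *: (h u : Hmod E))) ->
  (forall n x u, K (h u) -> h (Lop (@cmod_act k C M) (i x) n u) =
    gact (GL n (f x)) (h u)) ->
  forall a u, K (h u) -> h (a *: u) = Amap f a *: h u.
Proof.
move=> HK KL KR hD hZ hL.
have h0 : h 0 = 0 by have := hZ 0 0; rewrite !scale0r.
have aD (a b : algA k X) : Amap f (a + b) = Amap f a + Amap f b by exact: rmorphD.
have aM (a b : algA k X) : Amap f (a * b) = Amap f a * Amap f b by exact: rmorphM.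
have a1 : Amap f (1 : algA k X) = 1 by exact: rmorph1.
suff H a u : K (h u) -> K (h (a *: u)) /\ h (a *: u) = Amap f a *: h u.
  by move=> a u /(H a)[].
move: a u; apply: algA_ind => [c u Ku|a b ha hb u Ku|g a ha u Ku].
- rewrite opmod_C hZ; split; first exact: submodZ.
  by rewrite Amap_scale a1; exact: HmodC.
- have [Ka ea] := ha u Ku; have [Kb eb] := hb u Ku.
  rewrite scalerDl hD; split; first exact: (submodD HK).
  by rewrite ea eb aD scalerDl.
have [Ka ea] := ha u Ku.
rewrite aM Amap_gen -!scalerA -ea opmod_gen.
case: g => [|n x|n x] /=.
- rewrite hZ; split; first exact: submodZ.
  exact: HmodX.
- by rewrite hL //; split; first exact: KL.
- rewrite h0; split; first exact: (submod0 HK).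
  exact: esym (KR n x _ Ka).
Qed.

(** * Assembly of the presentation of C + M *)

Theorem theorem1 (k : fieldType) (char0 : [pchar k]%R =i pred0)
  (X Y : choiceType)
  (C : confAlg k) (i : X -> C) (N : X -> X -> nat) (S : set (freemod k X X))
  (presC : conf_alg_presented i N S)
  (M : confMod C) (j : Y -> M) (N' : X -> Y -> nat) (T : set (freemod k X Y))
  (presM : conf_mod_presented i j N' T) :
  conf_alg_presented (snull_gen i j) (snull_loc N N') (snull_rel S T).
Proof.
have [genC locC _] := presC; have [genM satM univM] := presM.
have [locM _] := satM.
have locD := snull_locality char0 locC locM.
split; [exact: snull_generated|exact: locD|].
pose NZ := snull_loc N N'; pose SZ := snull_rel S T.
have [g [glin gL gR gi]] := alg_section N' T presC.
pose U := Hmod (Defs.presM NZ SZ); pose o : ops (X + Y)%type U := Hmod_ops _.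
pose e : X + Y -> U := pgen NZ SZ.
have eL : forall a b n, (NZ a b <= n)%N -> opL o n a (e b) = 0 := @pgen_L _ _ NZ SZ.
have eR := pgen_R NZ SZ.
have Ly0 : forall n y u, opL o n (inr y) u = 0.
  move=> n y u; have [w <-] := presproj_surj u.
  apply: etrans (esym (semilinZ (presproj_semilin NZ SZ) _ w)) _.
  by apply: presproj_rel; right; exists y, n, w.
have Uind := @pres_ind _ _ NZ SZ.
have [act [actc actL]] :=
  module_extension (o := o) char0 genC glin gL gR gi eL eR Ly0 Uind.
pose M' : confMod C := ConfMod actc.
have KR := kerR_submod o.
have Ke : forall y, kerR o (e (inr y)) := e_kerR eL eR.
(* The relations T hold in the quotient with its own R; they hold in [M'], where R is replaced by
   zero, because the images of Y lie in the common kernel of the R. *)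
have sat' : satisfies i (fun y => e (inr y) : M') N' T.
  split=> [x y n h|t Tt].
    by apply: (factnI char0 (n := n)); rewrite mul0rn actL; exact: eL.
  have := @presproj_rel _ _ NZ SZ (freemod_map inl inr t).
  have -> : presproj NZ SZ (freemod_map inl inr t) =
      sfeval (Amap inl) (fun y => e (inr y) : Defs.presM NZ SZ) t.
    exact: (idfun_sfeval (Amap inl) (fun y => fbasis k _ (inr y)) t
      (presproj_semilin NZ SZ)).
  have h : SZ (freemod_map inl inr t) by left; right; exists t.
  move=> /(_ h) h0; rewrite -[RHS]h0; apply: eq_bigr => y _.
  pose idM (u : opmodule (mod_ops M' i)) : Defs.presM NZ SZ := u.
  have KL n x u : kerR o u -> kerR o (gact (GL n (inl x)) u).
    exact: (@kerR_L _ _ _ o u n (inl x)).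
  have K0 n x u : kerR o u -> gact (GR n (inl x)) u = 0 by move=> Ku; exact: Ku.
  have idD u v : idM (u + v) = idM u + idM v by [].
  have idZ p u : idM (p *: u : M') = (p *: (idM u : U)) by [].
  have idL n x u : kerR o (idM u) ->
    idM (Lop (@cmod_act k C M') (i x) n u) = gact (GL n (inl x)) (idM u : U).
    by move=> _; exact: actL.
  exact (mod_ops_Amap KR KL K0 idD idZ idL t@_y (Ke y)).
have [mh [mhom mj _]] := univM M' _ sat'.
(* All listed elements vanish in C + M, which gives the A(X + Y)-linear map from the quotient. *)
have [h [hl hp]] := pres_lift (fun u => snull_rel_eq0 presC satM)
  (fun u => alg_ops_Mrel char0 locD).
pose hL : {linear Defs.presM NZ SZ -> opmodule (alg_ops (snull_gen i j))} :=
  HB.pack h (GRing.isLinear.Build _ _ _ _ h hl).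
have hgen z : h (e z) = snull_gen i j z.
  by have := hp (fbasis k _ z); rewrite sfevalU scale1r.
exists hL; split; last exact: hgen.
apply: (extension_bij (o := o) (j := j) (h := h) (mh := mh)
  char0 genC glin gL gR gi eL eR Ly0 Uind genM).
- move=> p u v; have := hl (hornerA k _ p) u v; rewrite opmod_poly; exact.
- move=> n x u; have := semilinZ hl (Agen k (GL n (inl x))) u.
  by rewrite opmod_gen; exact.
- exact: hgen.
- by move=> p u v; rewrite linearP.
- by move=> x n v; rewrite /Lop -actL -mhom raddfMn.
- exact: mj.
Qed.
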